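(* Let $f:\mathbb{R}\to\mathbb{R}$ be a $1$-periodic function which is piecewise $C^1$, and continuous except possibly at $d$ points (in a period). Let $D_0:=\max_{x\in\mathbb{R}}\lim_{\varepsilon\to 0}|f(x+\varepsilon)-f(x-\varepsilon)|$ and $D_1:=\|f'\|_2$. Then for all $h\in\mathbb{Z}$, $k\in\mathbb{N}$ with $(h,k)=1$, \begin{align*} \left|S_f\left(\frac hk\right)\right|&\le \frac{dD_0}{\pi k}\sum_{m=1}^r v_m\log\left(\frac{v_m}{v_{m-1}}\right)+O(dD_0+D_1),\\ \left|S_f\left(\frac{\overline h}{k}\right)\right|&\le \frac{dD_0}{\pi}\sum_{m=0}^{r-1}\frac{\log\left(v_{m+1}/v_m\right)}{v_m}+O(dD_0+D_1), \end{align*} where $v_0,\dots,v_r$ are the denominators of the convergents of the continued fraction expansion of $h/k$, and the implied constants are absolute.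
   Context: For a $1$-periodic piecewise $C^1$ function $f$, $h\in\mathbb{Z}$ and $k\in\mathbb{N}=\{1,2,\dots\}$ with $(h,k)=1$, set $$S_f\left(\frac hk\right):=\frac1k\sum_{m=1}^{k-1} f\left(\frac mk\right)\cot\left(\pi\frac{mh}{k}\right).$$ $\overline h$ denotes any integer with $h\overline h\equiv 1 \pmod k$ (the value of $S_f(\overline h/k)$ does not depend on the choice). Piecewise $C^1$ has its usual meaning: there is a finite partition of a period such that on the interior of each subinterval $f$ agrees with a function that is $C^1$ on the closed subinterval. $\|f'\|_2:=\left(\int_0^1|f'(y)|^2\,dy\right)^{1/2}$, where $f'$ is the derivative of $f$ at the points where it exists. Continued fractions: write $h/k=[b_0;b_1,\dots,b_r]$ with $b_0\in\mathbb{Z}$, $b_i\ge1$ for $i\ge1$, and $b_r\ge2$ if $r\ge1$. The denominators of the convergents are given by $v_{-1}=0$, $v_0=1$, $v_{m+1}=b_{m+1}v_m+v_{m-1}$ for $0\le m<r$, so that $v_r=k$. Empty sums are $0$.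
   Formalization: The formal theorem additionally assumes that each value f(x) lies within D_0 of a one-sided limit of f at x; without this the claim fails, e.g. for f the indicator of 1/3+Z, where D_0=D_1=0 but S_f(1/3)=cot(π/3)/3≠0. *)

(* Defs.v *)
From HB Require Import structures.
From mathcomp Require Import all_boot all_order all_algebra.
From mathcomp Require Import all_classical all_reals all_analysis.
Set Implicit Arguments.
Unset Strict Implicit.
Unset Printing Implicit Defensive.
Import Order.TTheory GRing.Theory Num.Theory.
Import numFieldNormedType.Exports.
Local Open Scope classical_set_scope.
Local Open Scope ring_scope.

Definition cot {R : realType} (x : R) : R := cos x / sin x.

Definition cot_sum {R : realType} (f : R -> R) (h : int) (k : nat) : R :=
  k%:R^-1 * \sum_(1 <= m < k) f (m%:R / k%:R) * cot (pi * (m%:R * h%:~R / k%:R)).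

(* [dg] is the relative derivative of [g] on [a, b]: one-sided at a and b. *)
Definition C1_on {R : realType} (a b : R) (g : R -> R) : Prop :=
  exists dg : R -> R, {within `[a, b], continuous dg} /\
    forall x, x \in `[a, b] ->
      (g y - g x) / (y - x) @[y --> within `[a, b] x^'] --> dg x.

(* The partition is 0 < t_0 < ... < t_(n-1) = 1.  The values of f at the
   partition points themselves are not constrained. *)
Definition piecewise_C1 {R : realType} (f : R -> R) : Prop :=
  exists t : seq R, itv_partition 0 1 t /\
    forall i, (i < size t)%N ->
      exists2 g : R -> R, C1_on (nth 0 (0 :: t) i) (nth 0 t i) g &
        {in `]nth 0 (0 :: t) i, nth 0 t i[, f =1 g}.

Definition discontinuities {R : realType} (f : R -> R) : set R :=
  [set x | (x \in `[0, 1[) /\ ~ {for x, continuous f}].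

Definition jump {R : realType} (f : R -> R) (x : R) : R :=
  lim (`|f (x + e) - f (x - e)| @[e --> 0^']).

(* For a periodic piecewise C^1 function the jump takes finitely many values,
   so this supremum is a maximum. *)
Definition max_jump {R : realType} (f : R -> R) : R := sup (range (jump f)).

(* Without some control of the value of f at its discontinuities, the estimates
   for the cotangent sums fail: if f is the indicator of 1/k + Z, then
   max_jump f = 0 and f' = 0 almost everywhere, but
   cot_sum f 1 k = cot (pi / k) / k is not 0 for k > 2.  The condition below
   holds in particular when f x always lies between the two one-sided limits
   (left- or right-continuity, or the mean value normalization). *)
Definition values_near_limits {R : realType} (f : R -> R) : Prop :=
  forall x, exists2 l : R, (f y @[y --> x^'-] --> l) \/ (f y @[y --> x^'+] --> l)
                         & `|f x - l| <= max_jump f.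

(* [derive1] is a junk value where f is not differentiable, i.e. on a null set
   when f is piecewise C^1. *)
Definition deriv_L2norm {R : realType} (f : R -> R) : R :=
  Num.sqrt (\int[lebesgue_measure]_(x in `[0, 1]) (`|derive1 f x| ^+ 2)).

(* [cfrac b0 [:: b1; ...; br]] is b0 + 1/(b1 + 1/(... + 1/br)). *)
Fixpoint cfrac (b0 : rat) (b : seq nat) : rat :=
  if b is b1 :: b' then b0 + (cfrac b1%:R b')^-1 else b0.

Definition is_cfrac_expansion (q : rat) (b0 : int) (b : seq nat) : Prop :=
  [/\ q = cfrac b0%:~R b, all (fun c => 0 < c)%N b
    & b != [::] -> (2 <= last 0%N b)%N].

(* The list is b_1, ..., b_r, without b_0, so that [nth 0 b m] is b_(m+1). *)
Fixpoint cf_den (b : seq nat) (m : nat) : nat :=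
  if m is m1.+1 then
    (nth 0 b m1 * cf_den b m1 + (if m1 is m2.+1 then cf_den b m2 else 0))%N
  else 1%N.

(* Main.v *)
Require Import Defs.
From HB Require Import structures.
From mathcomp Require Import all_boot all_order all_algebra.
From mathcomp Require Import all_classical all_reals all_analysis.
From mathcomp Require Import measurable_realfun.
From mathcomp Require Import zify ring lra.
Import Order.TTheory GRing.Theory Num.Theory.
Import numFieldNormedType.Exports.
Local Open Scope classical_set_scope.
Local Open Scope ring_scope.
Set Implicit Arguments.
Unset Strict Implicit.
Unset Printing Implicit Defensive.

(** Write f on [[0, 1[] as a continuous function, minus the sum over its jumps
   of (jump) * (shifted sawtooth), plus an error supported on the discontinuities.

   The error contributes O(d D_0), since the cotangents are at most k.  For the
   continuous part, expand the cotangent in the sines sin(2 pi n m h / k), sum by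
   parts over m and apply Cauchy-Schwarz and the orthogonality of the cosines
   cos(2 pi (m + 1/2) n / k): only the L^2 norm of the increments is needed.

   For a sawtooth B(. - x), reindexing turns the sum for hbar into
   (1 / pi) sum_(j < k) (B(j a - x) - B(- j a - x)) / j + O(1) with a = h / k.
   The jumps of B all go down, so along a block of v_m consecutive j the
   perturbation from u_m / v_m to a costs at most v_m / v_(m+1), and the block
   sum of B is at most 1/2 + v_m / v_(m+1) in absolute value.  Summation by parts
   against 1 / j then gives sum_m log(v_(m+1) / v_m) / v_m + O(1) with the sharp
   constant.  The bound for h follows by reversing the continued fraction: if w
   are the denominators for the reversed expansion, then
   1 / w_(r-i) <= (v_i + v_(i-1)) / k. *)

(** * Continued fractions *)

(** The secondary losses stay O(1) for two reasons. A remainder of fewer than v_m terms costs at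
    most [weight m] = 2 (b_1 + ... + b_m). Each partial quotient is absorbed by v_m >= b_m v_(m-1),
    and v_(m+2) >= 2 v_m makes the rest summable. The leading constant is not spoiled, since c
    complete blocks lose at most c v_m / v_(m+1) <= 1 beyond c / 2; each of the two sawtooths thus
    contributes N / (2 v_m). Estimating the continuous part termwise would cost a factor log k,
    which is why only the L^2 norm of its increments is used. That part closes up over a period only
    after adding a linear term, whose slope is the total jump. Reversal is available because h
    v_(r-1) is 1 or -1 modulo k, and a sign does not affect the absolute value of a cotangent sum.
    The logarithms of the two expansions differ by bounded amounts, and these are summed against v_j
    / k. *)

Fixpoint den (b : nat -> nat) (m : nat) : nat :=
  if m is m1.+1 then
    (b m1 * den b m1 + (if m1 is m2.+1 then den b m2 else 0))%N
  else 1%N.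

Lemma cf_denE b m : cf_den b m = den (nth 0%N b) m.
Proof.
elim/ltn_ind: m => -[//|m] IH /=; rewrite IH //.
by case: m IH => [//|m] IH; rewrite IH //.
Qed.

Lemma eq_den b b' m : (forall i, (i < m)%N -> b i = b' i) -> den b m = den b' m.
Proof.
elim/ltn_ind: m => -[//|m] IH H /=; rewrite IH //; last first.
  by move=> i im; apply: H; lia.
rewrite H //; case: m IH H => [//|m] IH H; rewrite IH //.
by move=> i im; apply: H; lia.
Qed.

Section Den.
Variable b : nat -> nat.
Hypothesis b_gt0 : forall i, (0 < b i)%N.
Local Notation v := (den b).

Lemma denS_ge m : (b m * v m <= v m.+1)%N. Proof. by rewrite /= leq_addr. Qed.

Lemma den_gt0 m : (0 < v m)%N.
Proof.
elim: m => // m IH; apply: leq_trans (denS_ge m).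
by rewrite muln_gt0 b_gt0.
Qed.

Lemma den_leS m : (v m <= v m.+1)%N.
Proof. by apply: leq_trans (denS_ge m); rewrite leq_pmull. Qed.

Lemma denSS m : v m.+2 = (b m.+1 * v m.+1 + v m)%N. Proof. by []. Qed.

Lemma denS_le m : (v m.+1 <= (b m).+1 * v m)%N.
Proof.
case: m => [|m]; first by rewrite /= addn0; lia.
by rewrite denSS mulSn addnC leq_add2r den_leS.
Qed.

Lemma denSS_ge_add m : (v m.+1 + v m <= v m.+2)%N.
Proof. by rewrite denSS leq_add2r leq_pmull. Qed.

Lemma denSS_ge m : (2 * v m <= v m.+2)%N.
Proof. by have := denSS_ge_add m; have := den_leS m; lia. Qed.

End Den.

(** Euler's continuants, built from the front: for nonempty positive [s], [0; s] is
    [continuant (behead s)] over [continuant s], and the suffixes of [s] give the remainders of the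
    Euclidean algorithm. *)
Fixpoint continuant (s : seq nat) : nat :=
  if s is x :: s1 then
    (x * continuant s1 + (if s1 is _ :: s2 then continuant s2 else 0))%N
  else 1%N.

Lemma continuant_gt0 s : all (fun c => 0 < c)%N s -> (0 < continuant s)%N.
Proof. by elim: s => //= x s IH /andP[x0 /IH s0]; rewrite addn_gt0 muln_gt0 x0 s0. Qed.

Lemma continuant_drop s i : (i < size s)%N ->
  continuant (drop i s) = (nth 0 s i * continuant (drop i.+1 s)
     + (if (i.+1 < size s)%N then continuant (drop i.+2 s) else 0))%N.
Proof.
move=> i_s; rewrite (drop_nth 0%N) //=; congr addn.
by case: ltnP => H; [rewrite (drop_nth 0%N H)|rewrite drop_oversize].
Qed.

(** Denominators grow by appending a partial quotient, continuants by prepending one, so reversal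
    matches the two recurrences. *)
Lemma den_rev s m : (m <= size s)%N ->
  cf_den (rev s) m = continuant (drop (size s - m) s).
Proof.
elim/ltn_ind: m => -[_ _|m IH ms]; first by rewrite subn0 drop_size.
rewrite /= IH //; last by lia.
rewrite [RHS]continuant_drop; last by lia.
rewrite nth_rev //; congr (_ + _)%N; first by congr (_ * continuant (drop _ _))%N; lia.
case: m IH ms => [|m] IH ms.
  by rewrite ifN //; lia.
rewrite ifT; last by lia.
by rewrite IH //; [congr (continuant (drop _ _)); lia|lia].
Qed.

Lemma continuant_rev s : continuant (rev s) = cf_den s (size s).
Proof. by rewrite -{2}[s]revK -size_rev den_rev // subnn drop0. Qed.

Lemma continuant_behead_rev s : (0 < size s)%N ->
  continuant (behead (rev s)) = cf_den s (size s).-1.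
Proof.
move=> s0; rewrite -{2}[s]revK -size_rev den_rev ?leq_pred //.
by rewrite size_rev -drop1; congr (continuant (drop _ _)); lia.
Qed.

(* The state of the Euclidean algorithm run forward (denominators) and
   backward (continuants of the remaining partial quotients). *)
Lemma continuant_split s i : (i < size s)%N ->
  (continuant (drop i s) * cf_den s i
   + continuant (drop i.+1 s) * (if i is i1.+1 then cf_den s i1 else 0)
   = continuant s)%N.
Proof.
elim: i => [_|i IH i_s]; first by rewrite drop0 /= muln1 muln0 addn0.
rewrite -IH ?(ltnW i_s) // (continuant_drop (ltnW i_s)) i_s /=.
by case: i {IH} i_s => [|i] i_s /=; ring.
Qed.

Lemma continuantE s : continuant s = cf_den s (size s).
Proof.
case: (posnP (size s)) => [/size0nil -> //|s0].
have ss : ((size s).-1 < size s)%N by rewrite prednK.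
have s1 : (size s).-1.+1 = size s by rewrite prednK.
rewrite -(continuant_split ss) continuant_drop // s1 ltnn addn0 drop_size.
by move: s1; case: (size s).-1 => [|n] <- /=; ring.
Qed.

Lemma continuant_coprime s : coprime (continuant (behead s)) (continuant s).
Proof.
elim: s => [//|x s IH] /=.
case: s IH => [|y s] IH /=; first by rewrite coprime1n.
have := IH; rewrite /coprime /= => /eqP IH'.
by rewrite gcdnMDl gcdnC IH'.
Qed.

Lemma cfracE b0 s : all (fun c => 0 < c)%N s ->
  cfrac b0 s = b0 + (if s is _ :: s' then
     (continuant s')%:R / (continuant s)%:R else 0).
Proof.
elim: s b0 => [|x s IH] b0 /=; first by rewrite addr0.
case/andP => x0 s0; rewrite IH //; congr (_ + _).
have K0 := continuant_gt0 s0.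
case: s K0 {IH s0} => [|y s] /=; first by rewrite addr0 addn0 muln1 mul1r.
set K := (_ * _ + _)%N => K0.
rewrite natrD natrM.
have K1 : (K%:R : rat) != 0 by rewrite pnatr_eq0 -lt0n.
have -> : (x%:R + (continuant s)%:R / K%:R : rat) = (x%:R * K%:R + (continuant s)%:R)/ K%:R.
  by field.
by rewrite invf_div.
Qed.

(** Numerators of the convergents of [0; b_1, b_2, ...], with the value 1 at index -1. *)
Fixpoint cf_num (b : seq nat) (m : nat) : nat :=
  if m is m1.+1 then
    (nth 0 b m1 * cf_num b m1 + (if m1 is m2.+1 then cf_num b m2 else 1))%N
  else 0%N.

Definition prev (g0 : nat) (g : nat -> nat) (i : nat) : nat :=
  if i is j.+1 then g j else g0.

Lemma continuant_split_num s i : (i < size s)%N ->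
  (continuant (drop i s) * cf_num s i
   + continuant (drop i.+1 s) * prev 1 (cf_num s) i
   = continuant (behead s))%N.
Proof.
elim: i => [_|i IH i_s]; first by rewrite drop1 /= muln0 muln1.
rewrite -IH ?(ltnW i_s) // (continuant_drop (ltnW i_s)) i_s /=.
by case: i {IH} i_s => [|i] i_s /=; ring.
Qed.

Lemma cf_det s i :
  (cf_num s i)%:Z * (prev 0 (cf_den s) i)%:Z
  - (prev 1 (cf_num s) i)%:Z * (cf_den s i)%:Z = (-1) ^+ i.+1.
Proof.
elim: i => [//|i IH]; rewrite exprS -IH.
case: i {IH} => [|i] /=; first by rewrite !PoszD !PoszM; ring.
by rewrite !PoszD !PoszM; ring.
Qed.

Lemma cf_num_den_coprime s i : coprimez (cf_num s i)%:Z (cf_den s i)%:Z.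
Proof.
apply/coprimezP; have := cf_det s i; rewrite -signr_odd /= => H.
exists (if odd i then ((prev 0 (cf_den s) i)%:Z, - (prev 1 (cf_num s) i)%:Z)
  else (- (prev 0 (cf_den s) i)%:Z, (prev 1 (cf_num s) i)%:Z)).
by move: H; case: (odd i) => /= H; [rewrite mulNr mulrC|rewrite mulNr addrC [X in _ - X]mulrC];
  move: H; rewrite ?expr0 ?expr1; lia.
Qed.

(** The error is exactly E / (k v_i), with E the continuant of the partial quotients after b_(i+1),
    and E v_(i+1) <= k by [continuant_split]. *)
Lemma cf_approx (R : realType) s i : all (fun c => 0 < c)%N s -> (i < size s)%N ->
  `|(continuant (behead s))%:R / (continuant s)%:R
     - (cf_num s i)%:R / (cf_den s i)%:R|
    <= ((cf_den s i)%:R * (cf_den s i.+1)%:R)^-1 :> R.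
Proof.
move=> s_gt0 i_s.
have K0 := continuant_gt0 s_gt0.
have E0 : (0 < continuant (drop i.+1 s))%N.
  by apply: continuant_gt0; apply/allP => x /mem_drop; apply: (allP s_gt0).
have v_gt0 j : (j <= size s)%N -> (0 < cf_den s j)%N.
  move=> js; rewrite -[s]revK den_rev ?size_rev //.
  apply: continuant_gt0; apply/allP => x /mem_drop; rewrite mem_rev; apply: (allP s_gt0).
have vi := v_gt0 i (ltnW i_s); have vi1 := v_gt0 i.+1 i_s.
have E1 : (continuant (drop i.+1 s) * cf_den s i.+1 <= continuant s)%N.
  have := i_s; rewrite leq_eqVlt => /orP[/eqP e|i1s].
    by rewrite e drop_size /= mul1n -continuantE.
  by rewrite -(continuant_split i1s) leq_addr.
have d1 := continuant_split i_s; have d2 := continuant_split_num i_s.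
have d3 := cf_det s i.
set E := continuant (drop i.+1 s) in E0 E1 d1 d2 *.
set k := continuant s in K0 E1 d1 *; set h := continuant (behead s) in d2 *.
have hv : (h * cf_den s i)%:Z - (cf_num s i * k)%:Z = (-1) ^+ i * E%:Z :> int.
  have -> : (-1) ^+ i = - (-1) ^+ i.+1 :> int by rewrite exprS mulN1r opprK.
  rewrite -d3 -d1 -d2 !(PoszD, PoszM).
  by case: (i) => [|j] /=; ring.
have hvR : h%:R * (cf_den s i)%:R - (cf_num s i)%:R * k%:R = (-1) ^+ i * E%:R :> R.
  have := congr1 (intr : int -> R) hv.
  by rewrite rmorphB !rmorphM /= rmorphXn /= rmorphN1 -!natrM.
have kR : (k%:R : R) != 0 by rewrite pnatr_eq0 -lt0n.
have vR : ((cf_den s i)%:R : R) != 0 by rewrite pnatr_eq0 -lt0n.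
have -> : h%:R / k%:R - (cf_num s i)%:R / (cf_den s i)%:R
   = (-1) ^+ i * (E%:R / (k%:R * (cf_den s i)%:R)) :> R.
  by rewrite mulrA -hvR; field; rewrite kR vR.
rewrite normrM normrX normrN1 expr1n mul1r ger0_norm ?divr_ge0 //.
have v1R : ((cf_den s i.+1)%:R : R) != 0 by rewrite pnatr_eq0 -lt0n.
rewrite ler_pdivrMr ?mulr_gt0 ?ltr0n //.
rewrite [X in _ <= X](_ : _ = k%:R / (cf_den s i.+1)%:R); last by field; rewrite vR v1R.
by rewrite ler_pdivlMr ?ltr0n // -natrM ler_nat.
Qed.

(** * The sawtooth function along an arithmetic progression *)

Lemma sum_reindex (V : nmodType) (F : int -> V) (q : nat) (u n : int) :
  (forall x j, F (x + j * q%:Z) = F x) -> coprimez u q%:Z ->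
  \sum_(0 <= i < q) F (u * i%:Z + n) = \sum_(0 <= i < q) F i%:Z.
Proof.
move=> Fper uq; case: q Fper uq => [|q] Fper uq; first by rewrite !big_geq.
have Fmod x : F (x %% q.+1)%Z = F x.
  by rewrite {2}(divz_eq x q.+1) addrC Fper.
have mod_lt x : (`|(x %% q.+1)%Z| < q.+1)%N.
  by rewrite -ltz_nat gez0_abs ?modz_ge0 // ltz_pmod.
pose g (i : 'I_q.+1) := Ordinal (mod_lt (u * i%:Z + n)).
have g_inj : injective g.
  move=> i j /(congr1 val) /= /(congr1 Posz).
  rewrite !gez0_abs ?modz_ge0 // => /eqP; rewrite eqz_modDr.
  rewrite eqz_mod_dvd -mulrBr Gauss_dvdzr; last by rewrite coprimez_sym.
  rewrite -eqz_mod_dvd !modz_small ?ltz_nat ?ltn_ord //.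
  by move/eqP => -[] /val_inj.
rewrite !big_mkord [RHS](reindex_inj g_inj) /=.
by apply: eq_bigr => i _; rewrite gez0_abs ?modz_ge0 // Fmod.
Qed.

Lemma sum_reindex1 (V : zmodType) (F : int -> V) (q : nat) (u : int) :
  (forall x j, F (x + j * q%:Z) = F x) -> coprimez u q%:Z ->
  \sum_(1 <= i < q) F (u * i%:Z) = \sum_(1 <= i < q) F i%:Z.
Proof.
move=> Fper uq; case: q Fper uq => [|q] Fper uq; first by rewrite !big_geq.
have := sum_reindex 0 Fper uq; rewrite big_ltn // [X in _ = X -> _]big_ltn //.
under eq_bigr do rewrite addr0.
by rewrite mulr0 addr0 => /addrI.
Qed.

Section Saw.
Variable R : realType.
Implicit Types x y t s a : R.

Definition saw x : R := x - (Num.floor x)%:~R - 2^-1.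

Lemma sawDz x (n : int) : saw (x + n%:~R) = saw x.
Proof.
rewrite /saw floorDrz ?intr_int // intrKfloor rmorphD /=; ring.
Qed.

Lemma saw_le x : `|saw x| <= 2^-1.
Proof.
by rewrite ler_norml /saw; have := floor_le x; have := floorD1_gt x; rewrite rmorphD /=; lra.
Qed.

Lemma saw_itv x : 0 <= x < 1 -> saw x = x - 2^-1.
Proof. by move=> x01; rewrite /saw (floor_def (m := 0)) ?subr0 // add0r. Qed.

(** The floor is monotone. This one-sided inequality replaces any counting of the jumps crossed. *)
Lemma sawD_le x a : 0 <= a -> saw (x + a) <= saw x + a.
Proof.
move=> a0; rewrite /saw.
have : ((Num.floor x)%:~R : R) <= (Num.floor (x + a))%:~R by rewrite ler_int le_floor // lerDl.
lra.
Qed.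


(** With s = n / q + t and 0 <= q t < 1, the points are modulo 1 the numbers i / q + t of [0, 1),
    and the sum is exactly q t - 1/2. *)
Lemma saw_sum_rational (u : int) (q : nat) s : (0 < q)%N -> coprimez u q%:Z ->
  `|\sum_(0 <= i < q) saw (i%:R * (u%:~R / q%:R) + s)| <= 2^-1.
Proof.
move=> q0 uq; have qR : (0 : R) < q%:R by rewrite ltr0n.
have qN : (q%:R : R) != 0 by rewrite lt0r_neq0.
have [n [t [-> t0]]] : exists (n : int) t, s = n%:~R / q%:R + t /\ 0 <= q%:R * t < 1.
  exists (Num.floor (q%:R * s)), (s - (Num.floor (q%:R * s))%:~R / q%:R).
  split; first by rewrite addrC subrK.
  have := floor_le (q%:R * s); have := floorD1_gt (q%:R * s).
  by rewrite mulrBr [_ * (_ / _)]mulrC divfK // rmorphD /=; lra.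
pose F (x : int) := saw (x%:~R / q%:R + t).
have Fper (x j : int) : F (x + j * q%:Z) = F x.
  rewrite /F -(sawDz (x%:~R / q%:R + t) j) intrD intrM -pmulrn; congr saw.
  by field.
have -> : \sum_(0 <= i < q) saw (i%:R * (u%:~R / q%:R) + (n%:~R / q%:R + t))
    = \sum_(0 <= i < q) (i%:R / q%:R + (t - 2^-1)).
  rewrite (eq_bigr (fun i : nat => F (u * i%:Z + n))); last first.
    move=> i _; by rewrite /F intrD intrM -pmulrn; congr saw; field.
  rewrite sum_reindex // !big_nat; apply: eq_bigr => i /andP[_ iq].
  rewrite /F -pmulrn saw_itv; first by rewrite addrA.
  have t0' : 0 <= t by case/andP: t0; rewrite pmulr_rge0.
  have iq' : (i%:R + 1 : R) <= q%:R by rewrite natr1 ler_nat.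
  apply/andP; split; first by rewrite addr_ge0 // divr_ge0.
  have -> : i%:R / q%:R + t = (i%:R + q%:R * t) / q%:R by field.
  by rewrite ltr_pdivrMr // mul1r; lra.
rewrite big_split /= -mulr_suml sumr_const_nat subn0.
have -> : \sum_(0 <= i < q) (i%:R : R) = q%:R * (q%:R - 1) / 2.
  elim: (q) => [|m IH]; first by rewrite big_geq // !mul0r.
  by rewrite big_nat_recr //= IH -natr1; field.
rewrite -mulr_natl [X in `|X|](_ : _ = q%:R * t - 2^-1); last by field.
by rewrite ler_norml; lra.
Qed.

Lemma sum_le_const (F : nat -> R) (n : nat) (c : R) :
  (forall i, (i < n)%N -> F i <= c) -> \sum_(0 <= i < n) F i <= n%:R * c.
Proof.
move=> H; rewrite big_mkord mulr_natl -[n in c *+ n]card_ord -sumr_const.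
by apply: ler_sum => i _; apply: H.
Qed.

(* Along a block the perturbation [i * (a - u / q)] moves every point in the
   same direction by at most [q * |a - u / q|], and the jumps of [saw] all
   go down, so each one-sided bound can be read off an endpoint. *)
Lemma saw_sum_block_up (u : int) (q : nat) a s : (0 < q)%N -> coprimez u q%:Z ->
  \sum_(0 <= i < q) saw (i%:R * a + s)
    <= 2^-1 + q%:R ^+ 2 * `|a - u%:~R / q%:R|.
Proof.
move=> q0 uq; set p := u%:~R / q%:R; set e := `|a - p|.
have [s' Hs'] : exists s', forall i, (i < q)%N -> 
    saw (i%:R * a + s) <= saw (i%:R * p + s') + q%:R * e.
  have e0 : 0 <= e by apply: normr_ge0.
  have iqe i : (i < q)%N -> i%:R * e <= q%:R * e by move=> iq; rewrite ler_wpM2r // ler_nat ltnW.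
  have [pa|ap] := leP p a.
    have eE : e = a - p by rewrite /e ger0_norm // subr_ge0.
    exists s => i iq.
    have -> : i%:R * a + s = i%:R * p + s + i%:R * e by rewrite eE; ring.
    apply: le_trans (sawD_le _ _) _; first by rewrite mulr_ge0.
    by rewrite lerD2l iqe.
  have eE : e = p - a by rewrite /e ltr0_norm ?subr_lt0 // opprB.
  (* Starting q e earlier puts each perturbed point to the right of its rational counterpart, by (q
     - i) e, which lies between 0 and q e. *)
  exists (s - q%:R * e) => i iq.
  have -> : i%:R * a + s = i%:R * p + (s - q%:R * e) + (q%:R * e - i%:R * e) by rewrite eE; ring.
  apply: le_trans (sawD_le _ _) _; first by rewrite subr_ge0 iqe.
  by rewrite lerD2l gerBl mulr_ge0.
have := saw_sum_rational s' q0 uq; rewrite ler_norml -/p => /andP[_ H1].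
rewrite expr2 -mulrA.
apply: le_trans (_ : \sum_(0 <= i < q) (saw (i%:R * p + s') + q%:R * e) <= _).
  by rewrite !big_nat; apply: ler_sum => i /andP[_ iq]; apply: Hs'.
by rewrite big_split /= sumr_const_nat subn0 -[(_ * e) *+ q]mulr_natl lerD2r.
Qed.

Lemma saw_sum_block_low (u : int) (q : nat) a s : (0 < q)%N -> coprimez u q%:Z ->
  - (2^-1 + q%:R ^+ 2 * `|a - u%:~R / q%:R|) <= \sum_(0 <= i < q) saw (i%:R * a + s).
Proof.
move=> q0 uq; set p := u%:~R / q%:R; set e := `|a - p|.
have [s' Hs'] : exists s', forall i, (i < q)%N -> 
    saw (i%:R * p + s') - q%:R * e <= saw (i%:R * a + s).
  have e0 : 0 <= e by apply: normr_ge0.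
  have iqe i : (i < q)%N -> i%:R * e <= q%:R * e by move=> iq; rewrite ler_wpM2r // ler_nat ltnW.
  have [pa|ap] := leP p a.
    have eE : e = a - p by rewrite /e ger0_norm // subr_ge0.
    exists (s + q%:R * e) => i iq.
    have -> : i%:R * p + (s + q%:R * e) = i%:R * a + s + (q%:R * e - i%:R * e) by rewrite eE; ring.
    rewrite lerBlDr.
    apply: le_trans (sawD_le _ _) _; first by rewrite subr_ge0 iqe.
    by rewrite lerD2l gerBl mulr_ge0.
  have eE : e = p - a by rewrite /e ltr0_norm ?subr_lt0 // opprB.
  exists s => i iq.
  have -> : i%:R * p + s = i%:R * a + s + i%:R * e by rewrite eE; ring.
  rewrite lerBlDr.
  apply: le_trans (sawD_le _ _) _; first by rewrite mulr_ge0.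
  by rewrite lerD2l iqe.
have := saw_sum_rational s' q0 uq; rewrite ler_norml -/p => /andP[H1 _].
rewrite opprD expr2 -mulrA.
apply: le_trans (_ : _ <= \sum_(0 <= i < q) (saw (i%:R * p + s') - q%:R * e)) _.
  by rewrite sumrB sumr_const_nat subn0 -[(_ * e) *+ q]mulr_natl lerD2r.
by rewrite !big_nat; apply: ler_sum => i /andP[_ iq]; apply: Hs'.
Qed.

Lemma saw_sum_block (u : int) (q : nat) a s : (0 < q)%N -> coprimez u q%:Z ->
  `|\sum_(0 <= i < q) saw (i%:R * a + s)| <= 2^-1 + q%:R ^+ 2 * `|a - u%:~R / q%:R|.
Proof.
by move=> q0 uq; rewrite ler_norml saw_sum_block_low // saw_sum_block_up.
Qed.

End Saw.

(** * Discrepancy and harmonic sums of the sawtooth *)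

Lemma sum_shift (V : nmodType) (F : nat -> V) (n m : nat) :
  \sum_(0 <= i < n + m) F i = \sum_(0 <= i < n) F i + \sum_(0 <= i < m) F (n + i)%N.
Proof.
rewrite (big_cat_nat _ (n := n)) ?leq_addr //=; congr (_ + _).
rewrite -{1}[n]add0n big_addn addKn.
by apply: eq_bigr => i _; rewrite addnC.
Qed.

Section Discrepancy.
Variables (R : realType) (b : nat -> nat) (r : nat).
Hypothesis b_gt0 : forall i, (0 < b i)%N.
Local Notation v := (den b).
Implicit Types (a s x : R) (m N c : nat).

(** All that the sawtooth estimates need from the continued fraction of [a]. It is stable under
    negation, so it serves both terms of [odd_saw]. *)
Definition well_approx a := forall m, (m < r)%N ->
  exists2 u : int, coprimez u (v m)%:Z &
    `|a - u%:~R / (v m)%:R| <= ((v m)%:R * (v m.+1)%:R)^-1.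

Lemma well_approxN a : well_approx a -> well_approx (- a).
Proof.
move=> H m /H[u uv au]; exists (- u); first by rewrite coprimezE abszN -coprimezE.
by rewrite rmorphN /= mulNr -opprD normrN.
Qed.

(** The factor 2 is what the induction in [saw_sum_lt] asks for: (b + 1) / 2 + 1 <= 2 b when b >=
    1. *)
Definition weight m : R := \sum_(0 <= i < m) 2 * (b i)%:R.

Lemma weightS m : weight m.+1 = weight m + 2 * (b m)%:R.
Proof. by rewrite /weight big_nat_recr. Qed.

Let vR_gt0 m : (0 : R) < (v m)%:R. Proof. by rewrite ltr0n den_gt0. Qed.

Lemma saw_sum_blocks a m c s : well_approx a -> (m < r)%N ->
  `|\sum_(0 <= i < c * v m) saw (i%:R * a + s)|
    <= c%:R * (2^-1 + (v m)%:R / (v m.+1)%:R).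
Proof.
move=> Ha mr; have [u uv au] := Ha m mr.
elim: c s => [|c IH] s; first by rewrite mul0n big_geq // normr0 mul0r.
rewrite mulSn sum_shift -natr1 mulrDl mul1r addrC.
apply: le_trans (ler_normD _ _) _; apply: lerD.
  under eq_bigr do rewrite natrD mulrDl -addrA addrCA.
  exact: IH.
apply: le_trans (saw_sum_block _ _ (den_gt0 b_gt0 m) uv) _.
rewrite lerD2l; apply: le_trans (ler_wpM2l _ au) _; first exact: exprn_ge0.
have := vR_gt0 m.+1; have := vR_gt0 m; set p := (v m)%:R; set q := (v _)%:R => p0 q0.
by rewrite le_eqVlt; apply/orP; left; apply/eqP; field; rewrite !lt0r_neq0.
Qed.

(** Write N = c v_m + N'. The c blocks cost c / 2 + c v_m / v_(m+1), and the second term is at most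
    1 because c v_m <= N < v_(m+1). The bound for N' is a hypothesis, so that the same argument runs
    the induction of [saw_sum_lt] and then yields [saw_sum_le], where the term N / (2 v_m) is kept
    sharp. *)
Lemma saw_sum_weight a m N s : well_approx a -> (m < r)%N ->
  (forall N' s', (N' < v m)%N ->
      `|\sum_(0 <= i < N') saw (i%:R * a + s')| <= weight m) ->
  (N < v m.+1)%N ->
  `|\sum_(0 <= i < N) saw (i%:R * a + s)| <= N%:R / (2 * (v m)%:R) + 1 + weight m.
Proof.
move=> Ha mr IH Nv; rewrite {1}(divn_eq N (v m)) sum_shift.
apply: le_trans (ler_normD _ _) _; apply: lerD; last first.
  under eq_bigr do rewrite natrD mulrDl -addrA addrCA.
  by apply: IH; rewrite ltn_mod den_gt0.
apply: le_trans (saw_sum_blocks _ _ Ha mr) _; set c := (N %/ v m)%N.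
have cN : (c * v m <= N)%N by apply: leq_divM.
have cNR : (c%:R * (v m)%:R : R) <= N%:R by rewrite -natrM ler_nat.
rewrite mulrDr; apply: lerD.
  by rewrite ler_pdivlMr ?mulr_gt0 //; lra.
rewrite mulrA ler_pdivrMr // mul1r (le_trans cNR) // ler_nat; exact: ltnW.
Qed.

Lemma saw_sum_lt a m N s : well_approx a -> (m <= r)%N -> (N < v m)%N ->
  `|\sum_(0 <= i < N) saw (i%:R * a + s)| <= weight m.
Proof.
move=> Ha; elim: m N s => [|m IH] N s mr Nv.
  by move: Nv; rewrite /= ltnS leqn0 => /eqP ->; rewrite /weight !big_geq // normr0.
apply: le_trans (saw_sum_weight _ Ha mr (fun N s => IH N s (ltnW mr)) Nv) _.
rewrite weightS addrC lerD2l.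
have bR : (1 : R) <= (b m)%:R by rewrite ler1n.
suff : N%:R / (2 * (v m)%:R) <= ((b m)%:R + 1) / 2 :> R by lra.
rewrite ler_pdivrMr ?mulr_gt0 //.
have : (N%:R : R) <= (b m).+1%:R * (v m)%:R.
  by rewrite -natrM ler_nat (leq_trans (ltnW Nv)) // denS_le.
rewrite -natr1; lra.
Qed.

Lemma saw_sum_le a m N s : well_approx a -> (m < r)%N -> (N < v m.+1)%N ->
  `|\sum_(0 <= i < N) saw (i%:R * a + s)| <= N%:R / (2 * (v m)%:R) + 1 + weight m.
Proof.
move=> Ha mr; apply: saw_sum_weight => // N' s' N'v.
by apply: saw_sum_lt => //; exact: ltnW.
Qed.

(** What multiplies 1 / j once the parts 1 / m and 1 / (k - m) of the cotangent are merged by m -> k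
    - m. *)
Definition odd_saw a x (j : nat) := saw (j%:R * a - x) - saw (- (j%:R * a) - x).

Lemma odd_saw_le a x j : `|odd_saw a x j| <= 1.
Proof.
have := saw_le (j%:R * a - x); have := saw_le (- (j%:R * a) - x).
by rewrite /odd_saw !ler_norml; lra.
Qed.

Lemma odd_saw_sum_le a x m N : well_approx a -> (m < r)%N -> (N < v m.+1)%N ->
  `|\sum_(1 <= j < N.+1) odd_saw a x j| <= N%:R / (v m)%:R + 2 * (1 + weight m).
Proof.
move=> Ha mr Nv; rewrite big_add1 sumrB /=.
under eq_bigr do rewrite -natr1 mulrDl mul1r -addrA.
under [X in _ - X]eq_bigr do rewrite -natr1 mulrDl mul1r opprD -mulrN -addrA.
have H1 := saw_sum_le (a - x) Ha mr Nv.
have H2 := saw_sum_le (- a - x) (well_approxN Ha) mr Nv.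
apply: le_trans (ler_normB _ _) _; apply: le_trans (lerD H1 H2) _.
have -> : N%:R / (2 * (v m)%:R) = (N%:R / (v m)%:R) / 2 :> R by rewrite invfM mulrCA mulrC.
lra.
Qed.

Lemma abel_harmonic (g : nat -> R) n :
  \sum_(1 <= j < n.+1) g j / j%:R =
  \sum_(1 <= N < n.+1) (\sum_(1 <= j < N.+1) g j) * (N%:R^-1 - N.+1%:R^-1)
  + (\sum_(1 <= j < n.+1) g j) / n.+1%:R.
Proof.
elim: n => [|n IH]; first by rewrite !big_geq // mul0r addr0.
rewrite big_nat_recr //= IH [in RHS]big_nat_recr //= [X in _ = _ + _ + X / _]big_nat_recr //=.
by rewrite [X in _ = _ + X * _ + _]big_nat_recr //=; ring.
Qed.

(** This is ln (1 + u) <= u at u = - 1 / (N + 1). *)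
Lemma harmonic_step_le_ln N : (0 < N)%N -> N.+1%:R^-1 <= ln (N.+1%:R / N%:R) :> R.
Proof.
move=> N0; have N0R : (0 : R) < N%:R by rewrite ltr0n.
have N1R : (0 : R) < N.+1%:R by rewrite ltr0n.
have e : N.+1%:R / N%:R = (1 + - N.+1%:R^-1)^-1 :> R.
  rewrite -[LHS]invf_div; congr (_^-1); move: N1R; rewrite -natr1 => N1R.
  by field; rewrite lt0r_neq0.
have p : 0 < 1 + - N.+1%:R^-1 :> R.
  by rewrite subr_gt0 invf_lt1 // ltr1n.
rewrite e lnV ?posrE // lerNr; apply: le_ln1Dx.
by rewrite ltrN2 invf_lt1 // ltr1n.
Qed.

(** Since (N / v) (1 / N - 1 / (N + 1)) = 1 / (v (N + 1)), the main part becomes a logarithm, and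
    the part with G telescopes. *)
Lemma sum_level_le (v w : nat) (G : R) : (0 < v <= w)%N -> 0 <= G ->
  \sum_(v <= N < w) (N%:R / v%:R + 2 * G) * (N%:R^-1 - N.+1%:R^-1)
  <= ln (w%:R / v%:R) / v%:R + 2 * G * (v%:R^-1 - w%:R^-1).
Proof.
move=> /andP[v0 vw] G0; have v0R : (0 : R) < v%:R by rewrite ltr0n.
rewrite -(subnKC vw); elim: (w - v)%N => [|n IH].
  by rewrite addn0 big_geq // divff ?lt0r_neq0 // ln1 mul0r subrr mulr0 addr0.
rewrite addnS big_nat_recr ?leq_addr //=.
set N := (v + n)%N in IH *; have N0 : (0 < N)%N by rewrite addn_gt0 v0.
have N0R : (0 : R) < N%:R by rewrite ltr0n.
have N1R : (0 : R) < N.+1%:R by rewrite ltr0n.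
have -> : N.+1%:R / v%:R = (N.+1%:R / N%:R) * (N%:R / v%:R) :> R by field; rewrite !lt0r_neq0.
rewrite lnM ?posrE ?divr_gt0 //.
have := harmonic_step_le_ln N0 => H.
have -> : (N%:R / v%:R + 2 * G) * (N%:R^-1 - N.+1%:R^-1)
   = N.+1%:R^-1 / v%:R + 2 * G * (N%:R^-1 - N.+1%:R^-1) :> R.
  by move: N1R; rewrite -natr1 => N1R; field; rewrite !lt0r_neq0.
have : N.+1%:R^-1 / v%:R <= ln (N.+1%:R / N%:R) / v%:R :> R.
  by rewrite ler_pM2r // invr_gt0.
rewrite [X in _ <= X + _]mulrDl; move: IH.
move: (\sum_(_ <= _ < _) _) (ln (N%:R / _) / _) (ln (_ / N%:R) / _) (N.+1%:R^-1 / v%:R).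
by move: (N%:R^-1) (N.+1%:R^-1) (v%:R^-1) => x y z S l1 l2 e; lra.
Qed.

Lemma weight_ge0 m : 0 <= weight m.
Proof. by apply: sumr_ge0 => i _; rewrite mulr_ge0. Qed.

(** Summation by parts, with N sorted into levels v_m <= N < v_(m+1). The final 1 is the boundary
    term: fewer than v_r terms of size at most 1, divided by v_r. *)
Lemma odd_saw_harmonic_le a x : well_approx a ->
  `|\sum_(1 <= j < v r) odd_saw a x j / j%:R|
  <= \sum_(0 <= m < r) ln ((v m.+1)%:R / (v m)%:R) / (v m)%:R
     + 2 * (\sum_(0 <= m < r) (1 + weight m) / (v m)%:R) + 1.
Proof.
move=> Ha; have v_gt0 := den_gt0 b_gt0 r.
rewrite -(prednK v_gt0) abel_harmonic prednK //.
apply: le_trans (ler_normD _ _) _; apply: lerD; last first.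
  rewrite normrM [X in _ * X <= _]ger0_norm ?invr_ge0 // ler_pdivrMr // mul1r.
  apply: le_trans (ler_norm_sum _ _ _) _.
  rewrite big_add1 /=; apply: le_trans (sum_le_const (c := 1) _) _.
    by move=> i _; exact: odd_saw_le.
  by rewrite mulr1 ler_nat leq_pred.
apply: le_trans (ler_norm_sum _ _ _) _.
rewrite mulr_sumr -big_split /=.
suff H n : (n <= r)%N ->
    \sum_(1 <= N < v n) `|(\sum_(1 <= j < N.+1) odd_saw a x j) * (N%:R^-1 - N.+1%:R^-1)|
    <= \sum_(0 <= i < n) (ln ((v i.+1)%:R / (v i)%:R) / (v i)%:R
                           + 2 * ((1 + weight i) / (v i)%:R)) by exact: H.
elim: n => [|m IH] mr; first by rewrite !big_geq.
rewrite big_nat_recr //= (big_cat_nat _ (n := v m)) /= ?den_gt0 ?den_leS //.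
apply: lerD; first exact: IH (ltnW mr).
apply: le_trans (_ : \sum_(v m <= N < v m.+1)
   (N%:R / (v m)%:R + 2 * (1 + weight m)) * (N%:R^-1 - N.+1%:R^-1) <= _).
  rewrite !big_nat; apply: ler_sum => N /andP[vN Nv].
  have N0 : (0 < N)%N by apply: leq_trans vN; rewrite den_gt0.
  have dN : 0 <= N%:R^-1 - N.+1%:R^-1 :> R.
    by rewrite subr_ge0 lef_pV2 ?posrE ?ltr0n // ler_nat.
  by rewrite normrM (ger0_norm dN) ler_wpM2r // odd_saw_sum_le.
have G0 : 0 <= 1 + weight m by have := weight_ge0 m; lra.
apply: le_trans (sum_level_le _ G0) _; first by rewrite den_gt0 ?den_leS.
rewrite lerD2l mulrA ler_wpM2l ?mulr_ge0 //.
by rewrite gerBl invr_ge0.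
Qed.

Lemma sum_weight_le : \sum_(0 <= m < r) (1 + weight m) / (v m)%:R <= 36.
Proof.
(* [(1 + weight m) * t m] decreases by a multiple of the summand, up to an
   error absorbed by the decrease of [t]. *)
pose t m : R := (v m)%:R^-1 + (v m.+1)%:R^-1.
have t_ge0 m : 0 <= t m by rewrite addr_ge0 ?invr_ge0.
(* Two consecutive reciprocals are needed in [t] because the denominators are only sure to double
   every second step; then t n - t (n+1) >= 1 / (2 v_n). The growth of the weight costs 4 b_n t
   (n+1) <= 8 / v_n, which the factor 16 pays. As t 0 <= 2, the total is 4 + 32. *)
suff H n : \sum_(0 <= m < n) (1 + weight m) / (v m)%:R
    <= 2 * (t 0%N - (1 + weight n) * t n) + 16 * (t 0%N - t n).
  apply: le_trans (H r) _.
  have : t 0%N <= 2.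
    have : (v 1)%:R^-1 <= 1 :> R by rewrite invf_le1 // ler1n den_gt0.
    rewrite /t invr1; lra.
  have : 0 <= (1 + weight r) * t r by rewrite mulr_ge0 // addr_ge0 // weight_ge0.
  by have := t_ge0 r; lra.
elim: n => [|n IH]; first by rewrite /weight !big_geq //; lra.
rewrite big_nat_recr //= weightS.
have inv_le : (v n.+2)%:R^-1 <= (v n)%:R^-1 / 2 :> R.
  rewrite -invfM lef_pV2 ?posrE ?mulr_gt0 //.
  by rewrite mulrC -natrM ler_nat denSS_ge.
have tt : (v n)%:R^-1 / 2 <= t n - t n.+1 by rewrite /t; lra.
have bt : (b n)%:R * t n.+1 <= 2 * (v n)%:R^-1.
  have le1 : t n.+1 <= 2 * (v n.+1)%:R^-1.
    have : (v n.+2)%:R^-1 <= (v n.+1)%:R^-1 :> R.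
      by rewrite lef_pV2 ?posrE // ler_nat den_leS.
    rewrite /t; lra.
  apply: le_trans (ler_wpM2l _ le1) _ => //.
  rewrite mulrCA ler_wpM2l // ler_pdivrMr // mulrC ler_pdivlMr //.
  by rewrite -natrM ler_nat denS_ge.
have G1 : 1 <= 1 + weight n by have := weight_ge0 n; lra.
have : (1 + weight n) * ((v n)%:R^-1 / 2) <= (1 + weight n) * (t n - t n.+1).
  by rewrite ler_wpM2l //; lra.
move: IH bt tt; set S := \sum_(_ <= _ < _) _; set G := 1 + _; set B := (b n)%:R.
move: (t n) (t n.+1) (t 0%N) ((v n)%:R^-1) => tn tn1 t0 vi.
rewrite (_ : 1 + (weight n + 2 * B) = G + 2 * B); last by rewrite /G; ring.
nra.
Qed.

End Discrepancy.

(** * Trigonometric estimates *)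

Section Trig.
Variable R : realType.
Implicit Types x y t : R.

Lemma sin_MVT y : 0 <= y -> exists2 c, 0 <= c <= y & sin y = cos c * y.
Proof.
move=> y0; have [c cy H] := @MVT_segment R sin cos 0 y y0 (fun x _ => is_derive_sin x)
  (continuous_subspaceT (@continuous_sin R)).
by exists c; [move: cy; rewrite in_itv|move: H; rewrite sin0 !subr0].
Qed.

Lemma sin_ge_mul_cos y : 0 <= y <= pi -> y * cos y <= sin y.
Proof.
move=> /andP[y0 ypi]; have [c /andP[c0 cy] ->] := sin_MVT y0.
rewrite mulrC ler_wpM2r //; have [->//|cy'] := eqVneq c y.
by rewrite ltW // ltr_cos ?in_itv /= ?c0 ?y0 ?ypi ?(le_trans cy) // lt_neqAle cy' cy.
Qed.

(** The difference is (sin y - y cos y) / (y sin y). By sin y <= y the numerator is at most y (1 -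
    cos y), and 1 - cos y <= sin y on this range. *)
Lemma inv_sub_cot y : 0 < y <= pi / 2 -> 0 <= y^-1 - cot y <= 1.
Proof.
move=> /andP[y0 y2]; have pi0 := pi_gt0 R.
have s0 : 0 < sin y by apply: sin_gt0_pi; lra.
have c0 : 0 <= cos y by apply: cos_ge0_pihalf; lra.
have s1 := sin_le1 y; have c1 := cos_le1 y; have e := cos2Dsin2 y.
have sc : 1 - cos y <= sin y by nra.
have -> : y^-1 - cot y = (sin y - y * cos y) / (y * sin y).
  by rewrite /cot; field; rewrite !lt0r_neq0.
rewrite ler_pdivrMr ?mulr_gt0 // mul1r divr_ge0 ?mulr_ge0 ?(ltW s0) ?(ltW y0) //=.
  have sy : sin y <= y by have [c _ ->] := sin_MVT (ltW y0); rewrite ler_piMl ?cos_le1 // ltW.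
  have : y * (1 - cos y) <= y * sin y by rewrite ler_wpM2l // ltW.
  lra.
by rewrite subr_ge0 sin_ge_mul_cos //; lra.
Qed.

(** By the half-angle formulas, sin y >= y cos^2 (y / 2) = y (1 + cos y) / 2, and cos y >= 0. *)
Lemma sin_ge_half y : 0 <= y <= pi / 2 -> y / 2 <= sin y.
Proof.
move=> /andP[y0 y2]; have pi0 := pi_gt0 R.
have H : y / 2 * cos (y / 2) <= sin (y / 2) by apply: sin_ge_mul_cos; lra.
have c0 : 0 <= cos y by apply: cos_ge0_pihalf; lra.
have c1 : 0 <= cos (y / 2) by apply: cos_ge0_pihalf; lra.
have e : (y / 2) *+ 2 = y by rewrite mulr2n; field.
have eS : sin y = 2 * (cos (y / 2) * sin (y / 2)) by rewrite -{1}e sin_mulr2n mulr_natl.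
have eC : cos y = 2 * cos (y / 2) ^+ 2 - 1 by rewrite -{1}e cos_mulr2n mulr_natl.
have := ler_wpM2r c1 H; have := mulr_ge0 y0 c0; rewrite eC eS; nra.
Qed.

Lemma cotN x : cot (- x) = - cot x.
Proof. by rewrite /cot cosN sinN invrN mulrN. Qed.

Lemma cotDpi x : cot (x + pi) = cot x.
Proof. by rewrite /cot cosDpi sinDpi invrN mulrNN. Qed.

Lemma pi_le4 : pi <= 4 :> R. Proof. by have := pihalf_lt2 R; lra. Qed.

(** For x <= 1/2 the pole at 1 contributes between 0 and 2, and [inv_sub_cot] between - pi and 0.
    The map x -> 1 - x changes the sign of the whole expression. *)
Lemma cot_partial_fraction x : 0 < x < 1 ->
  `|pi * cot (pi * x) - (x^-1 - (1 - x)^-1)| <= 4.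
Proof.
have pi0 := pi_gt0 R; have pi4 := pi_le4.
have half y : 0 < y <= 2^-1 -> `|pi * cot (pi * y) - (y^-1 - (1 - y)^-1)| <= 4.
  move=> /andP[y0 y2].
  have /inv_sub_cot : 0 < pi * y <= pi / 2 by rewrite mulr_gt0 //= ler_pM2l.
  set e := _ - _ => /andP[e0 e1].
  have -> : cot (pi * y) = (pi * y)^-1 - e by rewrite /e; ring.
  have -> : pi * ((pi * y)^-1 - e) - (y^-1 - (1 - y)^-1) = (1 - y)^-1 - pi * e.
    by field; rewrite !lt0r_neq0 //; lra.
  have z0 : 0 <= (1 - y)^-1 by rewrite invr_ge0; lra.
  have z2 : (1 - y)^-1 <= 2 by rewrite invf_ple ?posrE //; lra.
  by rewrite ler_norml; nra.
move=> /andP[x0 x1]; have [x2|x2] := leP x 2^-1; first by apply: half; rewrite x0.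
have := half (1 - x) _; rewrite -normrN.
have -> : pi * (1 - x) = - (pi * x) + pi by ring.
rewrite cotDpi cotN [X in `|X|](_ : _ = pi * cot (pi * x) - (x^-1 - (1 - x)^-1)); last first.
  by rewrite (_ : 1 - (1 - x) = x); ring.
by apply; lra.
Qed.

Lemma period_int (f : R -> R) (T : R) (n : int) x :
  (forall y, f (y + T) = f y) -> f (x + T * n%:~R) = f x.
Proof.
move=> fT; have fn y (m : nat) : f (y + T * m%:R) = f y.
  elim: m y => [|m IH] y; first by rewrite mulr0 addr0.
  by rewrite -natr1 mulrDr mulr1 addrA fT IH.
case: n => n; first by rewrite -pmulrn fn.
by rewrite NegzE mulrNz -pmulrn -[RHS](fn _ n.+1) -[in LHS](fn _ n.+1) mulrN subrK fn.
Qed.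

Lemma cosD2piz x (n : int) : cos (x + 2 * pi * n%:~R) = cos x.
Proof. by apply: period_int => y; rewrite mulr_natl cosD2pi. Qed.

Lemma sinD2piz x (n : int) : sin (x + 2 * pi * n%:~R) = sin x.
Proof. by apply: period_int => y; rewrite mulr_natl sinD2pi. Qed.

Lemma sin2piz (n : int) : sin (2 * pi * n%:~R) = 0 :> R.
Proof. by rewrite -[2 * _ * _]add0r sinD2piz sin0. Qed.

Lemma norm_sinDpiz x (n : int) : `|sin (x + pi * n%:~R)| = `|sin x|.
Proof. by apply: (period_int (f := fun x => `|sin x|)) => y; rewrite sinDpi normrN. Qed.

Lemma cotDpiz x (n : int) : cot (x + pi * n%:~R) = cot x.
Proof. by apply: period_int => y; rewrite cotDpi. Qed.

Lemma sin_pi_frac_ge (k j : nat) : (0 < j < k)%N ->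
  (minn j (k - j))%:R / k%:R <= sin (pi * (j%:R / k%:R)) :> R.
Proof.
move=> /andP[j0 jk]; have pi2 := pi_ge2 R.
have k0 : (0 : R) < k%:R by rewrite ltr0n (leq_trans _ jk).
have half (i : nat) : (i.*2 <= k)%N -> i%:R / k%:R <= sin (pi * (i%:R / k%:R)) :> R.
  move=> ik; have x0 : (0 : R) <= i%:R / k%:R by rewrite divr_ge0 // ltW.
  have x2 : i%:R / k%:R <= 2^-1 :> R.
    by rewrite ler_pdivrMr // mulrC ler_pdivlMr // mulrC -natrM ler_nat mul2n.
  move: x0 x2; set x := _ / _ => x0 x2.
  apply: le_trans (_ : pi * x / 2 <= _); first nra.
  by apply: sin_ge_half; nra.
case: leqP => H; first by apply: half; lia.
have -> : pi * (j%:R / k%:R) = - (pi * ((k - j)%:R / k%:R)) + pi :> R.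
  by rewrite natrB ?(ltnW jk) //; field; rewrite lt0r_neq0.
by rewrite sinDpi sinN opprK; apply: half; lia.
Qed.

Lemma sin_pi_frac_gt0 (k j : nat) : (0 < j < k)%N -> 0 < sin (pi * (j%:R / k%:R)) :> R.
Proof.
move=> jk; apply: lt_le_trans (sin_pi_frac_ge jk).
by rewrite divr_gt0 // ltr0n; lia.
Qed.

Lemma norm_sin_pi_frac_ge (k : nat) (n : int) : (0 < k)%N -> ~~ (k %| n)%Z ->
  k%:R^-1 <= `|sin (pi * (n%:~R / k%:R))| :> R.
Proof.
move=> k0 kn; have kR : (k%:R : R) != 0 by rewrite pnatr_eq0 -lt0n.
have e : n%:~R / k%:R = (`|(n %% k)%Z|%N%:R / k%:R) + (n %/ k)%Z%:~R :> R.
  have -> : `|(n %% k)%Z|%N%:R = (n %% k)%Z%:~R :> R.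
    by rewrite pmulrn gez0_abs ?modz_ge0 // -lt0n.
  rewrite {1}(divz_eq n k) intrD intrM -pmulrn; by field.
have jk : (0 < `|(n %% k)%Z| < k)%N.
  have kz : (k : int) != 0 by rewrite -lt0n.
  rewrite absz_gt0 -ltz_nat gez0_abs ?modz_ge0 // ltz_pmod // andbT.
  by apply: contra kn => /eqP H; apply/dvdz_mod0P.
rewrite e mulrDr norm_sinDpiz; apply: le_trans (ler_norm _).
apply: le_trans (sin_pi_frac_ge jk).
by rewrite -[leLHS]mul1r ler_wpM2r ?invr_ge0 // ler1n; lia.
Qed.

Lemma sin_pi_neq0 (k : nat) (n : int) : (0 < k)%N -> ~~ (k %| n)%Z ->
  sin (pi * (n%:~R / k%:R)) != 0 :> R.
Proof.
move=> k0 kn; rewrite -normr_gt0; apply: lt_le_trans (norm_sin_pi_frac_ge k0 kn).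
by rewrite invr_gt0 ltr0n.
Qed.

Lemma norm_cot_pi_frac_le (k : nat) (n : int) : (0 < k)%N -> ~~ (k %| n)%Z ->
  `|cot (pi * (n%:~R / k%:R))| <= k%:R :> R.
Proof.
move=> k0 kn; have H := norm_sin_pi_frac_ge k0 kn.
have kp : (0 : R) < k%:R^-1 by rewrite invr_gt0 ltr0n.
rewrite /cot normrM normfV ler_pdivrMr ?(lt_le_trans kp) //.
apply: le_trans (cos_max _) _.
by rewrite -ler_pdivrMl ?ltr0n // mulr1.
Qed.

End Trig.

(** * The smooth part: discrete Fourier analysis *)

Section Fourier.
Variable R : realType.
Implicit Types (t : R) (G K beta : nat -> R).

Lemma two_sin_cos (x y : R) : 2 * sin x * cos y = sin (y + x) - sin (y - x).
Proof. by rewrite sinB sinD; ring. Qed.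

Lemma two_sin_sin (x y : R) : 2 * sin x * sin y = cos (y - x) - cos (y + x).
Proof. by rewrite cosB cosD; ring. Qed.

Lemma two_cos_cos (x y : R) : 2 * cos x * cos y = cos (x - y) + cos (x + y).
Proof. by rewrite cosB cosD; ring. Qed.

Lemma sum_cos_half t (N : nat) :
  2 * sin (t / 2) * (\sum_(0 <= m < N) cos ((m%:R + 2^-1) * t)) = sin (N%:R * t).
Proof.
elim: N => [|N IH]; first by rewrite big_geq // mul0r sin0 mulr0.
rewrite big_nat_recr //= mulrDr IH two_sin_cos -[N.+1%:R]natr1.
rewrite [X in _ + (sin X - _)](_ : _ = (N%:R + 1) * t); last by field.
rewrite [X in _ + (_ - sin X)](_ : _ = N%:R * t); last by field.
by rewrite addrC subrK.
Qed.

Lemma sum_mul_sin t (N : nat) :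
  2 * sin (t / 2) * (\sum_(0 <= n < N) n%:R * sin (n%:R * t))
  = \sum_(0 <= n < N) cos ((n%:R + 2^-1) * t) - N%:R * cos ((N%:R - 2^-1) * t).
Proof.
elim: N => [|N IH]; first by rewrite !big_geq // mul0r subr0 mulr0.
rewrite !big_nat_recr //= mulrDr IH mulrCA two_sin_sin -[N.+1%:R]natr1.
rewrite [X in _ * (cos X - _)](_ : _ = (N%:R - 2^-1) * t); last by field.
rewrite [X in _ * (_ - cos X)](_ : _ = (N%:R + 2^-1) * t); last by field.
rewrite [X in _ = _ - _ * cos X](_ : _ = (N%:R + 2^-1) * t); last by field.
ring.
Qed.

Lemma sum_cos_half_eq0 (k : nat) (n : int) : (0 < k)%N -> ~~ (k %| n)%Z ->
  \sum_(0 <= m < k) cos ((m%:R + 2^-1) * (2 * pi * (n%:~R / k%:R))) = 0 :> R.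
Proof.
move=> k0 kn; have kR : (k%:R : R) != 0 by rewrite pnatr_eq0 -lt0n.
have /(canRL (mulKf _)) := sum_cos_half (2 * pi * (n%:~R / k%:R)) k.
have -> : 2 * pi * (n%:~R / k%:R) / 2 = pi * (n%:~R / k%:R) :> R by field.
move=> ->; last by rewrite mulf_neq0 // sin_pi_neq0.
have -> : k%:R * (2 * pi * (n%:~R / k%:R)) = 2 * pi * n%:~R :> R by field.
by rewrite sin2piz mulr0.
Qed.

(** The finite Fourier expansion of the cotangent: at t = 2 pi n / k the cosine sum of [sum_mul_sin]
    vanishes and only the boundary term - k cos (pi n / k) survives. *)
Lemma cot_expansion (k : nat) (n : int) : (0 < k)%N -> ~~ (k %| n)%Z ->
  cot (pi * (n%:~R / k%:R))
  = - (2 / k%:R) * \sum_(0 <= j < k) j%:R * sin (j%:R * (2 * pi * (n%:~R / k%:R))) :> R.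
Proof.
move=> k0 kn; have kR : (k%:R : R) != 0 by rewrite pnatr_eq0 -lt0n.
have sN0 := sin_pi_neq0 R k0 kn.
have := sum_mul_sin (2 * pi * (n%:~R / k%:R)) k; rewrite sum_cos_half_eq0 //.
have -> : 2 * pi * (n%:~R / k%:R) / 2 = pi * (n%:~R / k%:R) :> R by field.
have -> : (k%:R - 2^-1) * (2 * pi * (n%:~R / k%:R))
  = - (pi * (n%:~R / k%:R)) + 2 * pi * n%:~R :> R by field.
rewrite cosD2piz cosN sub0r => H; rewrite /cot.
move: H sN0; set S := \sum_(_ <= _ < _) _; set sx := sin _; set cx := cos _ => H sN0.
have -> : S = - (k%:R * cx) / (2 * sx) by rewrite -H; field.
by field; rewrite kR sN0.
Qed.

Lemma abel_cyclic G K (N : nat) :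
  \sum_(0 <= m < N) G m * (K m - K m.+1)
  = \sum_(0 <= m < N) (G m.+1 - G m) * K m.+1 + G 0%N * K 0%N - G N * K N.
Proof.
elim: N => [|N IH]; first by rewrite !big_geq //; ring.
by rewrite !big_nat_recr //= IH; ring.
Qed.

Lemma cauchy_schwarz_sum (a b : nat -> R) (N : nat) :
  (\sum_(0 <= i < N) a i * b i) ^+ 2
  <= (\sum_(0 <= i < N) a i ^+ 2) * (\sum_(0 <= i < N) b i ^+ 2).
Proof.
elim: N => [|N IH]; first by rewrite !big_geq // expr0n mulr0.
rewrite !big_nat_recr //=.
have A0 : 0 <= \sum_(0 <= i < N) a i ^+ 2 by apply: sumr_ge0 => i _; apply: sqr_ge0.
have B0 : 0 <= \sum_(0 <= i < N) b i ^+ 2 by apply: sumr_ge0 => i _; apply: sqr_ge0.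
move: IH A0 B0; move: (\sum_(_ <= _ < _) a _ ^+ 2) (\sum_(_ <= _ < _) b _ ^+ 2).
move: (\sum_(_ <= _ < _) _) (a N) (b N) => C x y A B H A0 B0.
suff H1 : 2 * C * (x * y) <= A * y ^+ 2 + B * x ^+ 2.
  have -> : (C + x * y) ^+ 2 = C ^+ 2 + 2 * C * (x * y) + x ^+ 2 * y ^+ 2 by ring.
  have -> : (A + x ^+ 2) * (B + y ^+ 2)
     = A * B + (A * y ^+ 2 + B * x ^+ 2) + x ^+ 2 * y ^+ 2 by ring.
  by rewrite lerD2r lerD.
have P0 : 0 <= A * y ^+ 2 + B * x ^+ 2.
  by apply: addr_ge0; apply: mulr_ge0 => //; apply: sqr_ge0.
apply: le_trans (ler_norm _) _; rewrite -ler_sqr ?nnegrE //.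
rewrite real_normK ?num_real //.
have -> : (2 * C * (x * y)) ^+ 2 = 4 * C ^+ 2 * (x ^+ 2 * y ^+ 2) by ring.
apply: le_trans (_ : 4 * (A * B) * (x ^+ 2 * y ^+ 2) <= _).
  apply: ler_wpM2r; first by apply: mulr_ge0; apply: sqr_ge0.
  exact: ler_wpM2l.
rewrite -subr_ge0 [X in 0 <= X](_ : _ = (A * y ^+ 2 - B * x ^+ 2) ^+ 2); [exact: sqr_ge0|ring].
Qed.

Lemma sum_indicator_le (N p : nat) :
  \sum_(0 <= i < N) (i == p)%:R <= 1 :> R.
Proof.
suff -> : \sum_(0 <= i < N) (i == p)%:R = (p < N)%:R :> R by rewrite lern1; case: (_ < _)%N.
elim: N => [|N IH]; first by rewrite big_geq.
by rewrite big_nat_recr //= IH ltnS -natrD; case: ltngtP.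
Qed.

Section CotSum.
Variables (k : nat) (h : int).
Hypotheses (k_gt0 : (0 < k)%N) (hk : coprimez h k%:Z).
Local Notation t := (2 * pi * (h%:~R / k%:R) : R).

Let kR : (k%:R : R) != 0. Proof. by rewrite pnatr_eq0 -lt0n. Qed.

Let kNmul (n : int) : ~~ (k %| n)%Z -> ~~ (k %| n * h)%Z.
Proof. by rewrite Gauss_dvdzl // coprimez_sym. Qed.

Let kNnat (n : nat) : (0 < n < k)%N -> ~~ (k %| n%:Z)%Z.
Proof.
by move=> /andP[n0 nk]; apply/negP => /(dvdn_leq n0); rewrite leqNgt nk.
Qed.

Lemma sin_half_neq0 (n : nat) : (0 < n < k)%N -> sin (n%:R * t / 2) != 0.
Proof.
move=> nk; have -> : n%:R * t / 2 = pi * ((n%:Z * h)%:~R / k%:R).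
  by rewrite intrM -pmulrn; field.
by rewrite sin_pi_neq0 // kNmul // kNnat.
Qed.

Lemma sum_cos_half_le (n : int) :
  `|\sum_(0 <= m < k) cos ((m%:R + 2^-1) * (n%:~R * t))| <= (k %| n)%Z%:R * k%:R.
Proof.
case: (boolP (k %| n)%Z) => kn; last first.
  rewrite mul0r (eq_bigr (fun m : nat => cos ((m%:R + 2^-1) * (2 * pi * ((n * h)%:~R / k%:R))))).
    by rewrite sum_cos_half_eq0 ?normr0 // kNmul.
  by move=> m _; rewrite intrM; congr (cos (_ * _)); field.
rewrite mul1r; apply: le_trans (ler_norm_sum _ _ _) _.
apply: le_trans (sum_le_const (c := 1) _) _; last by rewrite mulr1.
by move=> i _; exact: cos_max.
Qed.

(** The product 2 sin (n t / 2) sin (m n t) is a difference in m of cosines at half-integer nodes,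
    so summation by parts moves the difference to G. The boundary terms cancel because G k = G 0 and
    the cosines have period k in m. *)
Lemma dual_sum_sin G (n : nat) : G k = G 0%N -> (0 < n < k)%N ->
  2 * sin (n%:R * t / 2) * \sum_(0 <= m < k) G m * sin (m%:R * (n%:R * t))
  = \sum_(0 <= m < k) (G m.+1 - G m) * cos ((m%:R + 2^-1) * (n%:R * t)).
Proof.
move=> Gk nk; rewrite mulr_sumr.
rewrite (eq_bigr (fun m : nat => G m * (cos ((m%:R - 2^-1) * (n%:R * t))
     - cos ((m.+1%:R - 2^-1) * (n%:R * t))))); last first.
  by move=> m _; rewrite mulrCA two_sin_sin -[m.+1%:R]natr1; congr (_ * (cos _ - cos _)); field.
have /= -> := abel_cyclic G (fun m : nat => cos ((m%:R - 2^-1) * (n%:R * t))) k.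
have -> : cos ((k%:R - 2^-1) * (n%:R * t)) = cos ((0%:R - 2^-1) * (n%:R * t)).
  rewrite -[RHS](cosD2piz _ (n%:Z * h)) intrM -pmulrn; congr cos; by field.
by rewrite Gk addrK; apply: eq_bigr => m _; rewrite -[m.+1%:R]natr1; congr (_ * cos (_ * _)); field.
Qed.

Definition dual_coef (n : nat) : R := n%:R / sin (n%:R * t / 2).

Lemma cot_sum_dual G : G k = G 0%N ->
  k%:R^-1 * (\sum_(1 <= m < k) G m * cot (pi * (m%:R * h%:~R / k%:R)))
  = - (k%:R ^- 2) * \sum_(0 <= m < k) (G m.+1 - G m) *
       \sum_(1 <= n < k) dual_coef n * cos ((m%:R + 2^-1) * (n%:R * t)).
Proof.
move=> Gk.
transitivity (- (2 / k%:R ^+ 2) * \sum_(1 <= n < k) n%:R *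
   \sum_(0 <= m < k) G m * sin (m%:R * (n%:R * t))).
  under [in RHS]eq_bigr do rewrite mulr_sumr.
  rewrite exchange_big /= [in RHS]big_ltn // [X in _ = _ * (X + _)]big1 ?add0r; last first.
    by move=> i _; rewrite mulr0n mul0r sin0 !mulr0.
  rewrite !mulr_sumr !big_nat; apply: eq_bigr => m mk.
  have -> : m%:R * h%:~R / k%:R = (m%:Z * h)%:~R / k%:R :> R by rewrite intrM -pmulrn.
  rewrite cot_expansion ?kNmul ?kNnat // [\sum_(0 <= _ < _) _]big_ltn // (mulr0n 1) mul0r add0r.
  rewrite !mulr_sumr; apply: eq_bigr => n _.
  rewrite [X in sin X](_ : _ = m%:R * (n%:R * t)); last by rewrite intrM -pmulrn; field.
  by field.
under [in RHS]eq_bigr do rewrite mulr_sumr.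
rewrite exchange_big /= !mulr_sumr !big_nat; apply: eq_bigr => n nk.
rewrite [in RHS](eq_bigr (fun m : nat =>
    dual_coef n * ((G m.+1 - G m) * cos ((m%:R + 2^-1) * (n%:R * t)))));
  last by move=> m _; rewrite mulrCA.
rewrite -[in RHS]mulr_sumr -dual_sum_sin // /dual_coef; field.
by rewrite kR sin_half_neq0.
Qed.

(** A row of the Gram matrix of the cosines is supported on p = n and p = k - n, each contributing
    at most k / 2. By 2 |beta n beta p| <= beta n ^ 2 + beta p ^ 2 only the row sums matter, and
    they are at most k. *)
Lemma bessel beta :
  \sum_(0 <= m < k) (\sum_(1 <= n < k) beta n * cos ((m%:R + 2^-1) * (n%:R * t))) ^+ 2
  <= k%:R * \sum_(1 <= n < k) beta n ^+ 2.
Proof.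
pose Gam (n p : nat) : R := \sum_(0 <= m < k)
  cos ((m%:R + 2^-1) * (n%:R * t)) * cos ((m%:R + 2^-1) * (p%:R * t)).
have GamC n p : Gam n p = Gam p n by apply: eq_bigr => m _; rewrite mulrC.
have Gam_le n p : (0 < n < k)%N -> (0 < p < k)%N ->
   `|Gam n p| <= k%:R / 2 * ((p == n)%:R + (p == k - n)%N%:R).
  move=> nk pk.
  have e : 2 * Gam n p = \sum_(0 <= m < k) cos ((m%:R + 2^-1) * ((n%:Z - p%:Z)%:~R * t))
     + \sum_(0 <= m < k) cos ((m%:R + 2^-1) * ((n%:Z + p%:Z)%:~R * t)).
    rewrite mulr_sumr -big_split /=; apply: eq_bigr => m _.
    rewrite mulrA two_cos_cos !intrD mulrNz -!pmulrn.
    by congr (cos _ + cos _); ring.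
  have d1 : (k %| (n%:Z - p%:Z))%Z = (p == n).
    apply/idP/eqP => [|->]; last by rewrite subrr dvdz0.
    by rewrite -eqz_mod_dvd !modz_small ?ltz_nat //; lia.
  have d2 : (k %| (n%:Z + p%:Z))%Z = (p == k - n)%N.
    apply/idP/eqP => [|->]; last by rewrite -PoszD subnKC ?dvdzz //; lia.
    by rewrite -PoszD => /dvdnP[[|[|q]]]; lia.
  have := sum_cos_half_le (n%:Z - p%:Z); have := sum_cos_half_le (n%:Z + p%:Z).
  rewrite d1 d2 => H1 H2.
  have : `|2 * Gam n p| <= (p == n)%:R * k%:R + (p == k - n)%N%:R * k%:R.
    by rewrite e; apply: le_trans (ler_normD _ _) _; rewrite lerD.
  by rewrite normrM ger0_norm //; lra.
have -> : \sum_(0 <= m < k) (\sum_(1 <= n < k) beta n * cos ((m%:R + 2^-1) * (n%:R * t))) ^+ 2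
   = \sum_(1 <= n < k) \sum_(1 <= p < k) beta n * beta p * Gam n p.
  under eq_bigr do rewrite expr2 big_distrlr /=.
  rewrite exchange_big /=; apply: eq_bigr => n _.
  rewrite exchange_big /=; apply: eq_bigr => p _.
  by rewrite mulr_sumr; apply: eq_bigr => m _; ring.
pose A (n p : nat) := beta n ^+ 2 * `|Gam n p|.
apply: le_trans (_ : \sum_(1 <= n < k) \sum_(1 <= p < k) ((A n p + A p n) / 2) <= _).
  apply: ler_sum => n _; apply: ler_sum => p _.
  rewrite /A (GamC p n); have := ler_norm (beta n * beta p * Gam n p).
  rewrite !normrM -[beta n ^+ 2]real_normK ?num_real // -[beta p ^+ 2]real_normK ?num_real //.
  have := normr_ge0 (Gam n p); move: `|Gam n p| `|beta n| `|beta p| => g x y g0 H.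
  apply: le_trans H _; have := mulr_ge0 (sqr_ge0 (x - y)) g0; nra.
have AE : \sum_(1 <= n < k) \sum_(1 <= p < k) ((A n p + A p n) / 2)
    = \sum_(1 <= n < k) \sum_(1 <= p < k) A n p.
  transitivity ((\sum_(1 <= n < k) \sum_(1 <= p < k) A n p
     + \sum_(1 <= n < k) \sum_(1 <= p < k) A p n) / 2).
    rewrite -big_split /= mulr_suml; apply: eq_bigr => n _.
    by rewrite -big_split /= mulr_suml.
  by rewrite [X in _ + X]exchange_big /=; field.
rewrite AE mulr_sumr !big_nat; apply: ler_sum => n nk.
rewrite /A -mulr_sumr mulrC ler_wpM2r ?sqr_ge0 //.
apply: le_trans (_ : \sum_(1 <= p < k) k%:R / 2 * ((p == n)%:R + (p == k - n)%N%:R) <= _).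
  by rewrite !big_nat; apply: ler_sum => p pk; apply: Gam_le.
rewrite -mulr_sumr big_split /=.
have ind p : \sum_(1 <= i < k) (i == p)%:R <= 1 :> R.
  apply: le_trans (sum_indicator_le k p).
  by rewrite [in X in _ <= X]big_ltn // lerDr.
have := ind n; have := ind (k - n)%N; have : (0 : R) <= k%:R by []; nra.
Qed.

Lemma sum_inv_sqr_le (N : nat) : \sum_(1 <= n < N) (n%:R ^- 2) <= 2 :> R.
Proof.
suff H M : \sum_(1 <= n < M.+2) (n%:R ^- 2) <= 2 - M.+1%:R^-1 :> R.
  case: N => [|[|N]]; [by rewrite big_geq|by rewrite big_geq|].
  by apply: le_trans (H N) _; rewrite gerBl invr_ge0.
elim: M => [|M IH]; first by rewrite big_nat1 expr1n !invr1; lra.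
rewrite big_nat_recr //=.
suff : M.+2%:R ^- 2 <= M.+1%:R^-1 - M.+2%:R^-1 :> R.
  move: IH; move: (M.+1%:R^-1) (M.+2%:R^-1) (M.+2%:R ^- 2) (\sum_(_ <= _ < _) _).
  by move=> x y z S; lra.
have m0 : (0 : R) < M.+1%:R by rewrite ltr0n.
have -> : M.+2%:R = M.+1%:R + 1 :> R by rewrite natr1.
move: M.+1%:R m0 => x x0.
have -> : x^-1 - (x + 1)^-1 = (x * (x + 1))^-1 by field; rewrite !lt0r_neq0 //; lra.
rewrite lef_pV2 ?posrE ?mulr_gt0 ?exprn_gt0 //; nra.
Qed.

(** As h is prime to k, n h runs over the nonzero residues and h may be replaced by 1. Then sin (pi
    n / k) >= min (n, k - n) / k, and the two resulting sums of inverse squares are at most 2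
    each. *)
Lemma sum_inv_sin_sqr_le :
  \sum_(1 <= n < k) (sin (n%:R * t / 2) ^- 2) <= 4 * k%:R ^+ 2.
Proof.
pose F (n : int) : R := `|sin (pi * (n%:~R / k%:R))| ^- 2.
have Fper x j : F (x + j * k%:Z) = F x.
  rewrite /F -(norm_sinDpiz (pi * (x%:~R / k%:R)) j) intrD intrM -pmulrn.
  by congr (`|sin _| ^- 2); field.
have -> : \sum_(1 <= n < k) (sin (n%:R * t / 2) ^- 2) = \sum_(1 <= n < k) F n%:Z.
  rewrite -(sum_reindex1 Fper hk); apply: eq_bigr => n _.
  rewrite /F real_normK ?num_real //; congr (sin _ ^- 2).
  by rewrite intrM -pmulrn; field.
apply: le_trans (_ : \sum_(1 <= n < k) k%:R ^+ 2 * (n%:R ^- 2 + (k - n)%N%:R ^- 2) <= _).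
  rewrite !big_nat; apply: ler_sum => n nk.
  have s0 := sin_pi_frac_gt0 R nk; have sm := sin_pi_frac_ge R nk.
  rewrite /F -pmulrn ger0_norm ?(ltW s0) //.
  have m0 : (0 : R) < (minn n (k - n))%:R by rewrite ltr0n; lia.
  apply: le_trans (_ : ((minn n (k - n))%:R / k%:R) ^- 2 <= _).
    have p0 : (0 : R) < (minn n (k - n))%:R / k%:R by rewrite divr_gt0 // ltr0n.
    rewrite lef_pV2 ?posrE; [|exact: exprn_gt0|exact: exprn_gt0].
    by rewrite ler_sqr // nnegrE ltW.
  rewrite expr_div_n invf_div ler_wpM2l ?exprn_ge0 //.
  by case: leqP => _; rewrite ?lerDl ?lerDr invr_ge0 exprn_ge0.
rewrite -mulr_sumr big_split /= mulrC ler_wpM2r ?sqr_ge0 //.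
have -> : \sum_(1 <= n < k) (k - n)%N%:R ^- 2 = \sum_(1 <= n < k) (n%:R ^- 2) :> R.
  by rewrite big_nat_rev /= !big_nat; apply: eq_bigr => n nk; congr (_%:R ^- 2); lia.
by have := sum_inv_sqr_le k; lra.
Qed.

(** In Cauchy-Schwarz the increments give D^2 / k, and the trigonometric factor is at most 4 k^5: k
    from [bessel], k^2 from the numerators n < k of [dual_coef], 4 k^2 from the sines. The squared
    prefactor k^(-4) leaves 4 D^2. *)
Lemma cot_sum_smooth_le G (D : R) : G k = G 0%N ->
  \sum_(0 <= m < k) (G m.+1 - G m) ^+ 2 <= D ^+ 2 / k%:R -> 0 <= D ->
  `|k%:R^-1 * (\sum_(1 <= m < k) G m * cot (pi * (m%:R * h%:~R / k%:R)))| <= 2 * D.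
Proof.
move=> Gk HD D0; have k0 : (0 : R) < k%:R by rewrite ltr0n.
rewrite cot_sum_dual // -ler_sqr ?nnegrE ?mulr_ge0 // real_normK ?num_real //.
rewrite exprMn sqrrN.
pose X (m : nat) := \sum_(1 <= n < k) dual_coef n * cos ((m%:R + 2^-1) * (n%:R * t)).
have HX : \sum_(0 <= m < k) X m ^+ 2 <= 4 * k%:R ^+ 5.
  apply: le_trans (bessel dual_coef) _.
  apply: le_trans (_ : k%:R * (k%:R ^+ 2 * (4 * k%:R ^+ 2)) <= _); last first.
    by rewrite le_eqVlt; apply/orP; left; apply/eqP; ring.
  rewrite ler_wpM2l //; apply: le_trans (ler_wpM2l _ sum_inv_sin_sqr_le); last exact: exprn_ge0.
  rewrite mulr_sumr !big_nat; apply: ler_sum => n /andP[_ nk].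
  rewrite /dual_coef expr_div_n ler_wpM2r ?invr_ge0 ?sqr_ge0 //.
  by rewrite ler_sqr ?nnegrE // ler_nat ltnW.
have H := cauchy_schwarz_sum (fun m => G m.+1 - G m) X k.
have H2 : (\sum_(0 <= m < k) (G m.+1 - G m) * X m) ^+ 2 <= D ^+ 2 / k%:R * (4 * k%:R ^+ 5).
  apply: le_trans H _; apply: ler_pM => //; by apply: sumr_ge0 => i _; apply: sqr_ge0.
apply: le_trans (ler_wpM2l _ H2) _; first exact: sqr_ge0.
by rewrite le_eqVlt; apply/orP; left; apply/eqP; field.
Qed.

End CotSum.
End Fourier.

(** * Cotangent sums of shifted sawtooths *)

Section SawCotSum.
Variable R : realType.
Implicit Types (s : seq nat) (x : R) (g h : int).

(** Padding with 1 instead of 0 keeps every partial quotient positive, so the results on [den] apply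
    without index bounds. *)
Lemma den_nth1 s m : (m <= size s)%N -> den (nth 1%N s) m = cf_den s m.
Proof.
move=> ms; rewrite cf_denE; apply: eq_den => i im.
by apply: set_nth_default; apply: leq_trans ms.
Qed.

Lemma nth1_gt0 s i : all (fun c => 0 < c)%N s -> (0 < nth 1%N s i)%N.
Proof.
move=> s_gt0; case: (ltnP i (size s)) => H; last by rewrite nth_default.
exact: (allP s_gt0 _ (mem_nth _ H)).
Qed.

Lemma cot_frac_approx (k m : nat) : (0 < m < k)%N ->
  `|k%:R^-1 * cot (pi * (m%:R / k%:R)) - pi^-1 * (m%:R^-1 - (k - m)%N%:R^-1)|
  <= 4 / (pi * k%:R) :> R.
Proof.
move=> /andP[m0 mk]; have k0 : (0 : R) < k%:R by rewrite ltr0n (leq_trans _ mk).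
have m0R : (0 : R) < m%:R by rewrite ltr0n.
have mkR : (0 : R) < k%:R - m%:R by rewrite subr_gt0 ltr_nat.
have pi0 := pi_gt0 R.
have := @cot_partial_fraction R (m%:R / k%:R).
rewrite divr_gt0 //= ltr_pdivrMr // mul1r ltr_nat => /(_ mk) H.
rewrite natrB ?(ltnW mk) //.
have -> : k%:R^-1 * cot (pi * (m%:R / k%:R)) - pi^-1 * (m%:R^-1 - (k%:R - m%:R)^-1)
  = (pi * k%:R)^-1 * (pi * cot (pi * (m%:R / k%:R))
      - ((m%:R / k%:R)^-1 - (1 - m%:R / k%:R)^-1)) :> R.
  by move: (@pi R) pi0 (cot _) => p p0 c; field; rewrite !lt0r_neq0.
have pk0 : 0 < (pi * k%:R)^-1 :> R by rewrite invr_gt0 mulr_gt0.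
by rewrite normrM gtr0_norm // mulrC ler_pM2r.
Qed.

(** By m -> k - m the part - 1 / (k - m) of the cotangent becomes - 1 / m against the sawtooth at -
    m a / k - x. The k errors of [cot_frac_approx], halved by |saw| <= 1/2, add up to at most 2 / pi
    <= 1. *)
Lemma saw_cot_sum_unit_le (k : nat) (a : int) x : (0 < k)%N ->
  `|k%:R^-1 * (\sum_(1 <= m < k) saw (m%:R * (a%:~R / k%:R) - x) * cot (pi * (m%:R / k%:R)))|
  <= pi^-1 * `|\sum_(1 <= m < k) odd_saw (a%:~R / k%:R) x m / m%:R| + 1.
Proof.
move=> k_gt0; have k0 : (0 : R) < k%:R by rewrite ltr0n.
have pi0 := pi_gt0 R; have pi2 := pi_ge2 R.
set al := a%:~R / k%:R.
pose F (m : nat) := saw (m%:R * al - x).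
pose G (m : nat) : R := k%:R^-1 * cot (pi * (m%:R / k%:R)) - pi^-1 * (m%:R^-1 - (k - m)%N%:R^-1).
have -> : k%:R^-1 * (\sum_(1 <= m < k) F m * cot (pi * (m%:R / k%:R)))
  = pi^-1 * (\sum_(1 <= m < k) odd_saw al x m / m%:R) + \sum_(1 <= m < k) F m * G m.
  have -> : \sum_(1 <= m < k) odd_saw al x m / m%:R
     = \sum_(1 <= m < k) F m * (m%:R^-1 - (k - m)%N%:R^-1).
    rewrite /odd_saw; under eq_bigr do rewrite mulrBl.
    under [in RHS]eq_bigr do rewrite mulrBr.
    rewrite !sumrB; congr (_ - _).
    rewrite big_nat_rev /= !big_nat; apply: eq_bigr => m /andP[m0 mk].
    have -> : (1 + k - m.+1 = k - m)%N by lia.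
    congr (_ * _); rewrite /F natrB ?(ltnW mk) // -(sawDz (m%:R * al - x) (- a)).
    by rewrite mulrNz /al; congr saw; field; rewrite lt0r_neq0.
  by rewrite !mulr_sumr -big_split /=; apply: eq_bigr => m _; rewrite /G; ring.
apply: le_trans (ler_normD _ _) _; apply: lerD.
  by rewrite normrM ger0_norm // invr_ge0 ltW.
apply: le_trans (ler_norm_sum _ _ _) _.
apply: le_trans (_ : \sum_(1 <= m < k) (2 / (pi * k%:R)) <= _).
  rewrite !big_nat; apply: ler_sum => m mk; rewrite normrM.
  apply: le_trans (ler_pM _ _ (saw_le _) (cot_frac_approx mk)) _ => //.
  rewrite le_eqVlt; apply/orP; left; apply/eqP.
  by move: (@pi R) pi0 => p p0; field; rewrite !lt0r_neq0.
rewrite sumr_const_nat -[_ *+ (k - 1)]mulr_natl mulrA ler_pdivrMr ?mulr_gt0 // mul1r.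
have : ((k - 1)%N%:R : R) <= k%:R by rewrite ler_nat leq_subr.
nra.
Qed.

(** Substituting m -> b m, with b the inverse of g, reduces the cotangents to pi m / k and moves b /
    k = [0; s] into the sawtooth, where its convergents apply. The constant covers (2 * 36 + 1) / pi
    + 1. *)
Lemma saw_cot_sum_le s g x : all (fun c => 0 < c)%N s ->
  (g * (continuant (behead s))%:Z = 1 %[mod (continuant s)%:Z])%Z ->
  `|(continuant s)%:R^-1 * (\sum_(1 <= m < continuant s)
      saw (m%:R / (continuant s)%:R - x) * cot (pi * (m%:R * g%:~R / (continuant s)%:R)))|
  <= pi^-1 * (\sum_(0 <= m < size s)
                ln ((cf_den s m.+1)%:R / (cf_den s m)%:R) / (cf_den s m)%:R) + 38.
Proof.
move=> s_gt0; set k := continuant s => gb; have k_gt0 : (0 < k)%N by apply: continuant_gt0.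
have kR : (k%:R : R) != 0 by rewrite pnatr_eq0 -lt0n.
set b := (continuant (behead s))%:Z in gb.
pose F (n : int) := saw (n%:~R / k%:R - x) * cot (pi * (n%:~R * g%:~R / k%:R)).
have Fper (n j : int) : F (n + j * k%:Z) = F n.
  rewrite /F -(sawDz (n%:~R / k%:R - x) j) -(cotDpiz (pi * (n%:~R * g%:~R / k%:R)) (j * g)).
  by rewrite intrD !intrM -pmulrn; congr (saw _ * cot _); field.
have bk : coprimez b k%:Z by rewrite /b coprimezE !absz_nat continuant_coprime.
have [q Hq] : exists q : int, g * b = 1 + q * k%:Z.
  move/eqP: gb; rewrite eqz_mod_dvd => /dvdzP[q Hq]; exists q.
  by rewrite -Hq addrC subrK.
have -> : \sum_(1 <= m < k) saw (m%:R / k%:R - x) * cot (pi * (m%:R * g%:~R / k%:R))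
  = \sum_(1 <= m < k) saw (m%:R * (b%:~R / k%:R) - x) * cot (pi * (m%:R / k%:R)).
  transitivity (\sum_(1 <= m < k) F m%:Z); first by apply: eq_bigr => m _; rewrite /F -pmulrn.
  rewrite -(sum_reindex1 Fper bk); apply: eq_bigr => m _.
  rewrite /F -(cotDpiz (pi * (m%:R / k%:R)) (m%:Z * q)); congr (saw _ * cot _).
    by rewrite intrM -pmulrn; field.
  have := congr1 (intr : int -> R) Hq; rewrite !(intrD, intrM) -!pmulrn => HqR.
  have -> : b%:~R * m%:R * g%:~R = m%:R * (g%:~R * b%:~R) :> R by ring.
  by rewrite HqR; field.
apply: le_trans (saw_cot_sum_unit_le _ _ k_gt0) _.
have nth_gt0 i := @nth1_gt0 s i s_gt0.
have Ha : well_approx (nth 1%N s) (size s) (b%:~R / k%:R : R).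
  move=> m ms; exists (cf_num s m)%:Z.
    by rewrite den_nth1 ?(ltnW ms) // cf_num_den_coprime.
  by rewrite !den_nth1 ?(ltnW ms) // -!pmulrn; apply: cf_approx.
have := odd_saw_harmonic_le nth_gt0 x Ha; have := sum_weight_le R (size s) nth_gt0.
rewrite den_nth1 // -continuantE -/k.
set S1 := \sum_(_ <= _ < _) _; set S2 := \sum_(_ <= _ < _) _; set S3 := \sum_(_ <= _ < _) _.
have -> : S3 = \sum_(0 <= m < size s)
                ln ((cf_den s m.+1)%:R / (cf_den s m)%:R) / (cf_den s m)%:R.
  by rewrite /S3 !big_nat; apply: eq_bigr => m /andP[_ ms]; rewrite !den_nth1 ?(ltnW ms).
set S4 := \sum_(_ <= _ < _) _ => H1 H2.
have pi0 := pi_gt0 R; have pi2 := pi_ge2 R.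
have p0 : 0 <= pi^-1 :> R by rewrite invr_ge0 ltW.
have p2 : pi^-1 <= 2^-1 :> R by rewrite lef_pV2 ?posrE.
have := ler_wpM2l p0 (le_trans H2 (_ : _ <= S4 + 73)); nra.
Qed.

Lemma cf_den_gt0 s m : all (fun c => 0 < c)%N s -> (m <= size s)%N -> (0 < cf_den s m)%N.
Proof.
by move=> s_gt0 ms; rewrite -den_nth1 //; apply: den_gt0 => i; exact: nth1_gt0.
Qed.

(** From v_(n+2) >= v_(n+1) + v_n, by induction v_1 + ... + v_n <= v_n + v_(n+1). *)
Lemma sum_cf_den_le s : all (fun c => 0 < c)%N s -> (0 < size s)%N ->
  (\sum_(0 <= j < size s) cf_den s j.+1 <= 3 * cf_den s (size s))%N.
Proof.
move=> s_gt0 s0.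
have nth_gt0 i := @nth1_gt0 s i s_gt0.
pose v := den (nth 1%N s).
suff H n : (\sum_(0 <= j < n) v j.+1 <= v n + v n.+1)%N.
  have -> : (\sum_(0 <= j < size s) cf_den s j.+1 = \sum_(0 <= j < size s) v j.+1)%N.
    by rewrite !big_nat; apply: eq_bigr => j /andP[_ js]; rewrite /v den_nth1.
  rewrite -den_nth1 // -/v -(prednK s0) big_nat_recr //=.
  have := H (size s).-1; have := den_leS nth_gt0 (size s).-1; rewrite -/v.
  rewrite prednK //; lia.
elim: n => [|n IH]; first by rewrite big_geq.
rewrite big_nat_recr //=; have := denSS_ge_add nth_gt0 n; rewrite -/v.
move: IH; rewrite -/(v n.+2); lia.
Qed.

(** The terms are compared one by one, with E_j = [continuant (drop j s)] as reversed denominators.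
    Since E_j / E_(j+1) <= 1 + b_(j+1) and v_(j+1) / v_j >= b_(j+1), reversal raises a logarithm by
    at most ln 2 <= 1. In 1 / E_(j+1) <= (v_(j+1) + v_j) / k the second part is harmless, as ln (1 +
    b_(j+1)) v_j <= v_(j+1). The excess 2 v_(j+1) / k sums to at most 6. *)
Lemma reverse_log_sum_le s : all (fun c => 0 < c)%N s -> (0 < size s)%N ->
  \sum_(0 <= m < size s) ln ((cf_den (rev s) m.+1)%:R / (cf_den (rev s) m)%:R)
                           / (cf_den (rev s) m)%:R
  <= (continuant s)%:R^-1 *
       (\sum_(1 <= m < (size s).+1)
          (cf_den s m)%:R * ln ((cf_den s m)%:R / (cf_den s m.-1)%:R)) + 6 :> R.
Proof.
move=> s_gt0 s0; have K0 := continuant_gt0 s_gt0.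
set k := continuant s in K0 *; have kR : (0 : R) < k%:R by rewrite ltr0n.
have E_gt0 i : (0 < continuant (drop i s))%N.
  by apply: continuant_gt0; apply/allP => y /mem_drop; apply: (allP s_gt0).
rewrite big_add1 -pred_Sn big_nat_rev.
apply: le_trans (_ : \sum_(0 <= j < size s)
   (k%:R^-1 * ((cf_den s j.+1)%:R * ln ((cf_den s j.+1)%:R / (cf_den s j)%:R))
   + 2 / k%:R * (cf_den s j.+1)%:R) <= _); last first.
  rewrite big_split /= -!mulr_sumr lerD2l -natr_sum.
  have := sum_cf_den_le s_gt0 s0; rewrite -continuantE -/k -(ler_nat R) natrM.
  rewrite mulrAC ler_pdivrMr //; lra.
rewrite !big_nat; apply: ler_sum => j /andP[_ js].
have -> : (0 + size s - j.+1).+1 = (size s - j)%N by lia.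
rewrite add0n !den_rev ?leq_subr //.
have -> : (size s - (size s - j) = j)%N by lia.
have -> : (size s - (size s - j.+1) = j.+1)%N by lia.
have vj : (0 < cf_den s j)%N by rewrite cf_den_gt0 // ltnW.
have vj1 : (0 < cf_den s j.+1)%N by rewrite cf_den_gt0.
have bj : (0 < nth 0%N s j)%N by apply: (allP s_gt0); apply: mem_nth.
have Ele : (continuant (drop j.+2 s) <= continuant (drop j.+1 s))%N.
  case: (ltnP j.+1 (size s)) => H; last by rewrite !drop_oversize // ltnW.
  rewrite (continuant_drop H); have := allP s_gt0 _ (mem_nth 0%N H).
  by move=> H0; apply: leq_trans (leq_addr _ _); rewrite leq_pmull.
have E1 : (continuant (drop j s) <= (nth 0 s j).+1 * continuant (drop j.+1 s))%N.
  by rewrite continuant_drop // mulSn addnC leq_add2r; case: ifP.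
have E2 : (continuant (drop j.+1 s) <= continuant (drop j s))%N.
  by rewrite (continuant_drop js); apply: leq_trans (leq_addr _ _); rewrite leq_pmull.
have V1 : (nth 0 s j * cf_den s j <= cf_den s j.+1)%N by rewrite /= leq_addr.
have kE : (k <= continuant (drop j.+1 s) * (cf_den s j.+1 + cf_den s j))%N.
  have := js; rewrite leq_eqVlt => /orP[/eqP e|js1].
    by rewrite e drop_size /= mul1n /k continuantE -e leq_addr.
  by rewrite /k -(continuant_split js1) mulnDr leq_add2l leq_mul2r Ele orbT.
move: E1 E2 V1 kE (E_gt0 j) (E_gt0 j.+1) vj vj1 bj.
move: (continuant (drop j s)) (continuant (drop j.+1 s)) (cf_den s j) (cf_den s j.+1) (nth 0%N s j).
move=> E E' v v' b; rewrite -!(ler_nat R) !natrM natrD -[b.+1%:R]natr1.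
move: (E%:R) (E'%:R) (v%:R) (v'%:R) (b%:R) => {E E' v v' b}.
move: (k%:R) kR => K Kp E E' v v' b E1 E2 V1 kE E0 E'0 v0 v'0 b1.
have E'p : 0 < E' by lra.
have vp : 0 < v by lra.
have y1 : 1 <= E / E' by rewrite ler_pdivlMr // mul1r.
have yb : E / E' <= 1 + b by rewrite ler_pdivrMr // addrC.
have bv : b <= v' / v by rewrite ler_pdivlMr.
set L := ln (E / E'); set l := ln (v' / v).
have L0 : 0 <= L by rewrite ln_ge0.
have Lb : L <= b.
  apply: le_trans (_ : ln (1 + b) <= _); first by rewrite ler_ln ?posrE //; lra.
  by apply: le_ln1Dx; lra.
have Ll : L <= l + 1.
  have ln2 : ln (1 + 1) <= 1 :> R by apply: le_ln1Dx; lra.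
  have -> : L = ln (1 + 1) + (L - ln (1 + 1)) by ring.
  suff : L <= ln (1 + 1) + l by lra.
  rewrite /l -lnM ?posrE; [|lra|lra].
  by rewrite ler_ln ?posrE; [|lra|rewrite mulr_gt0 //; lra]; lra.
rewrite ler_pdivrMr //.
have -> : (K^-1 * (v' * l) + 2 / K * v') * E' = (v' * l + 2 * v') * E' / K by ring.
rewrite ler_pdivlMr //.
have : L * K <= L * (E' * (v' + v)) by rewrite ler_wpM2l.
have : L * v <= b * v by rewrite ler_wpM2r // ltW.
have : v' * L <= v' * (l + 1) by rewrite ler_wpM2l //; lra.
move=> h1 h2 h3; apply: le_trans h3 _.
have -> : L * (E' * (v' + v)) = (v' * L + L * v) * E' by ring.
rewrite ler_wpM2r ?(ltW E'p) //; lra.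
Qed.

(** Both fractions are in lowest terms, so each denominator divides the other. *)
Lemma cfrac_reduced h (k : nat) (b0 : int) s : (0 < k)%N -> coprimez h k%:Z ->
  all (fun c => 0 < c)%N s -> h%:~R / k%:R = cfrac b0%:~R s :> rat -> (0 < size s)%N ->
  k = continuant s /\ h = b0 * k%:Z + (continuant (behead s))%:Z.
Proof.
move=> k0 hk s_gt0; rewrite cfracE // => H s0.
have K0 := continuant_gt0 s_gt0; have := continuant_coprime s.
case: s s0 s_gt0 K0 H => [//|c s] _ s_gt0; rewrite [behead _]/=.
set K := continuant (c :: s); set b := continuant s => K0 H bK.
have kR : (k%:R : rat) != 0 by rewrite pnatr_eq0 -lt0n.
have KR : (K%:R : rat) != 0 by rewrite pnatr_eq0 -lt0n.
have e : h * K%:Z = (b0 * K%:Z + b%:Z) * k%:Z.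
  apply: (intr_inj (R := rat)); rewrite !intrM intrD intrM -!pmulrn.
  have -> : h%:~R = (b0%:~R + b%:R / K%:R) * k%:R :> rat by rewrite -H divfK.
  by field.
have bK' : coprimez (b0 * K%:Z + b%:Z) K%:Z.
  by rewrite coprimez_sym /coprimez gcdzMDl gcdzC; exact: bK.
have kK : (k %| K%:Z)%Z.
  rewrite -(@Gauss_dvdzr _ h) 1?coprimez_sym //; apply/dvdzP.
  by exists (b0 * K%:Z + b%:Z).
have Kk : (K %| k%:Z)%Z.
  rewrite -(@Gauss_dvdzr _ (b0 * K%:Z + b%:Z)) 1?coprimez_sym //; apply/dvdzP.
  by exists h; rewrite -e.
have kE : k = K by apply/eqP; rewrite eqn_dvd; apply/andP; split.
split=> //; move: e; rewrite -kE; apply: mulIf; by rewrite -lt0n.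
Qed.

Lemma saw_cot_sum_inv_le h hbar (k : nat) (b0 : int) s x :
  (0 < k)%N -> coprimez h k%:Z -> all (fun c => 0 < c)%N s ->
  h%:~R / k%:R = cfrac b0%:~R s :> rat -> (h * hbar = 1 %[mod k%:Z])%Z ->
  (0 < size s)%N ->
  `|k%:R^-1 * (\sum_(1 <= m < k) saw (m%:R / k%:R - x) * cot (pi * (m%:R * hbar%:~R / k%:R)))|
  <= pi^-1 * (\sum_(0 <= m < size s)
                ln ((cf_den s m.+1)%:R / (cf_den s m)%:R) / (cf_den s m)%:R) + 41.
Proof.
move=> k0 hk s_gt0 H hh s0; have [kE hE] := cfrac_reduced k0 hk s_gt0 H s0.
(* The constant 41 is larger than needed, to agree with [saw_cot_sum_den_le]. *)
apply: le_trans (_ : _ <= pi^-1 * (\sum_(0 <= m < size s)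
                ln ((cf_den s m.+1)%:R / (cf_den s m)%:R) / (cf_den s m)%:R) + 38) _; last lra.
rewrite kE; apply: saw_cot_sum_le => //; rewrite -kE -hh hE mulrDl.
by rewrite mulrAC [hbar * _]mulrC modzMDl.
Qed.

(** By [cf_det] at the last index, h v_(r-1) is 1 or -1 modulo k, and v_(r-1) / k has the reversed
    expansion. So up to sign h plays the part of the inverse for [rev s], and cot is odd. The
    constant is 38 + 6 / 2, by 1 / pi <= 1/2. *)
Lemma saw_cot_sum_den_le h (k : nat) (b0 : int) s x :
  (0 < k)%N -> coprimez h k%:Z -> all (fun c => 0 < c)%N s ->
  h%:~R / k%:R = cfrac b0%:~R s :> rat -> (0 < size s)%N ->
  `|k%:R^-1 * (\sum_(1 <= m < k) saw (m%:R / k%:R - x) * cot (pi * (m%:R * h%:~R / k%:R)))|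
  <= (pi * k%:R)^-1 * (\sum_(1 <= m < (size s).+1)
          (cf_den s m)%:R * ln ((cf_den s m)%:R / (cf_den s m.-1)%:R)) + 41.
Proof.
move=> k0 hk s_gt0 H s0; have [kE hE] := cfrac_reduced k0 hk s_gt0 H s0.
have pi0 := pi_gt0 R; have pi2 := pi_ge2 R.
have rs_gt0 : all (fun c => 0 < c)%N (rev s) by rewrite all_rev.
have revK : continuant (rev s) = k by rewrite continuant_rev kE continuantE.
have revb := continuant_behead_rev s0.
have [sg sgE] : exists sg : int, (sg = 1 \/ sg = -1) /\
    (sg * h * (cf_den s (size s).-1)%:Z = 1 %[mod k%:Z])%Z.
  have numE : cf_num s (size s) = continuant (behead s).
    have s1 : ((size s).-1 < size s)%N by rewrite prednK.
    rewrite -(continuant_split_num s1) continuant_drop // prednK // ltnn addn0 drop_size.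
    by move: s1; case: (size s) => [//|[|n]] _ /=; ring.
  have := cf_det s (size s); rewrite numE -continuantE -kE.
  have -> : prev 0 (cf_den s) (size s) = cf_den s (size s).-1 by case: (size s) s0.
  set w := (cf_den s _)%:Z; set u := (prev _ _ _)%:Z => det.
  exists ((-1) ^+ (size s).+1); split.
    by rewrite -signr_odd; case: odd; [right|left].
  have -> : (-1) ^+ (size s).+1 * h * w
      = 1 + ((-1) ^+ (size s).+1 * (b0 * w + u)) * k%:Z.
    have sq : (-1) ^+ (size s).+1 * (-1) ^+ (size s).+1 = 1 :> int.
      by rewrite -expr2 sqrr_sign.
    rewrite hE -[X in _ = X + _]sq -{3}det; ring.
  by rewrite addrC modzMDl.
case: sgE => sg1 sgE.
have := @saw_cot_sum_le (rev s) (sg * h) x rs_gt0; rewrite revK revb => /(_ sgE).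
have -> : `|k%:R^-1 * (\sum_(1 <= m < k)
    saw (m%:R / k%:R - x) * cot (pi * (m%:R * (sg * h)%:~R / k%:R)))|
  = `|k%:R^-1 * (\sum_(1 <= m < k)
    saw (m%:R / k%:R - x) * cot (pi * (m%:R * h%:~R / k%:R)))|.
  case: sg1 => ->; first by rewrite mul1r.
  rewrite -[RHS]normrN -mulrN -sumrN; congr (`|_ * _|); apply: eq_bigr => m _.
  by rewrite mulN1r mulrNz mulrN mulNr mulrN cotN mulrN.
rewrite size_rev; have := reverse_log_sum_le s_gt0 s0; rewrite -kE.
set S1 := \sum_(_ <= _ < _) _; set S2 := \sum_(_ <= _ < _) _ => H1 H2.
apply: le_trans H2 _.
have p0 : 0 <= pi^-1 :> R by rewrite invr_ge0 ltW.
have p2 : pi^-1 <= 2^-1 :> R by rewrite lef_pV2 ?posrE.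
have := ler_wpM2l p0 H1; rewrite invfM mulrDr mulrA; lra.
Qed.

End SawCotSum.

(** * Calculus on a partition *)

Section Calculus.
Variable R : realType.
Implicit Types (f g : R -> R) (a b x y : R).
Local Notation mu := (@lebesgue_measure R).

Lemma C1_on_is_derive f g dg a b x :
  (g y - g x) / (y - x) @[y --> within `[a, b] x^'] --> dg x ->
  {in `]a, b[, f =1 g} -> x \in `]a, b[ -> is_derive x 1 f (dg x).
Proof.
move=> Hlim fg xab; have := xab; rewrite in_itv /= => /andP[ax xb].
suff H : h^-1 *: ((f \o shift x) (h *: (1 : R)) - f x) @[h --> 0^'] --> dg x.
  have fd : derivable f x 1 by apply/cvg_ex; exists (dg x).
  by apply: DeriveDef => //; exact: cvg_lim.
apply/cvgrPdist_lt => e e0; move/cvgrPdist_lt : Hlim => /(_ e e0).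
move=> /nbhs_ballP[dl /= dl0 Hd].
near=> h.
have h0 : h != 0 by near: h; exact: nbhs_dnbhs_neq.
have hd : `|h| < Num.min dl (Num.min (x - a) (b - x)).
  by near: h; apply: dnbhs0_lt; rewrite !lt_min dl0 !subr_gt0 ax xb.
move: hd; rewrite !lt_min => /and3P[hd ha hb].
have hab : h + x \in `]a, b[.
  by move: ha hb; rewrite in_itv /= !ltr_norml; lra.
have := Hd (h + x); rewrite /ball /= opprD addrCA subrr addr0 normrN => /(_ hd).
rewrite -subr_eq0 addrK => /(_ h0).
have -> : h *: (1 : R) + x = h + x by rewrite /GRing.scale /= mulr1.
rewrite -!fg //.
have -> : h^-1 *: (f (h + x) - f x) = (f (h + x) - f x) / h by rewrite /GRing.scale /= mulrC.
by apply; apply: subset_itv_oo_cc.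
Unshelve. all: by end_near. Qed.

Lemma lim_at_right f a b (l M : R) : a < b ->
  (forall y, a < y < b -> `|f y - l| <= M * (y - a)) -> f y @[y --> a^'+] --> l.
Proof.
move=> ab H; apply/cvgrPdist_le => e e0.
have M0 : 0 < `|M| + 1 by rewrite ltr_pwDr.
near=> y; have ay : a < y by near: y; exact: nbhs_right_gt.
have yb : y < b by near: y; exact: nbhs_right_lt.
have ye : y < a + e / (`|M| + 1).
  by near: y; apply: nbhs_right_lt; rewrite ltrDl divr_gt0.
rewrite distrC; apply: le_trans (H y _) _; first by rewrite ay.
have : (y - a) * (`|M| + 1) <= e by rewrite -ler_pdivlMr // lerBlDl ltW.
have := ler_norm M; nra.
Unshelve. all: by end_near. Qed.

Lemma lim_at_left f a b (l M : R) : a < b ->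
  (forall y, a < y < b -> `|f y - l| <= M * (b - y)) -> f y @[y --> b^'-] --> l.
Proof.
move=> ab H; apply/cvgrPdist_le => e e0.
have M0 : 0 < `|M| + 1 by rewrite ltr_pwDr.
near=> y; have yb : y < b by near: y; exact: nbhs_left_lt.
have ay : a < y by near: y; exact: nbhs_left_gt.
have ye : b - e / (`|M| + 1) < y.
  by near: y; apply: nbhs_left_gt; rewrite gtrBl divr_gt0.
rewrite distrC; apply: le_trans (H y _) _; first by rewrite ay.
have : (b - y) * (`|M| + 1) <= e by rewrite -ler_pdivlMr //; lra.
have := ler_norm M; nra.
Unshelve. all: by end_near. Qed.

Lemma lim_at_dnbhs0 f (l M dl : R) : 0 < dl ->
  (forall e, 0 < `|e| < dl -> `|f e - l| <= M * `|e|) -> f e @[e --> 0^'] --> l.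
Proof.
move=> dl0 H; apply/cvgrPdist_le => e e0.
have M0 : 0 < `|M| + 1 by rewrite ltr_pwDr.
near=> y; have y0 : y != 0 by near: y; exact: nbhs_dnbhs_neq.
have yd : `|y| < dl by near: y; exact: dnbhs0_lt.
have ye : `|y| < e / (`|M| + 1) by near: y; apply: dnbhs0_lt; rewrite divr_gt0.
rewrite distrC; apply: le_trans (H y _) _; first by rewrite normr_gt0 y0.
have : `|y| * (`|M| + 1) <= e by rewrite -ler_pdivlMr // ltW.
have := ler_norm M; have := normr_ge0 y; nra.
Unshelve. all: by end_near. Qed.

Section PiecewiseIntegral.
Variables (F : R -> R) (P : nat -> R) (n : nat).
Hypothesis P0 : P 0%N = 0.
Hypothesis Pn : P n = 1.
Hypothesis P_lt : forall i, (i < n)%N -> P i < P i.+1.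
Hypothesis F_cont : forall i, (i < n)%N -> exists2 dg : R -> R,
  {within `[P i, P i.+1], continuous dg} & {in `]P i, P i.+1[, F =1 dg}.

Lemma knot_le i j : (i <= j <= n)%N -> P i <= P j.
Proof.
move=> /andP[ij jn]; rewrite -(subnKC ij); move: jn; rewrite -{1}(subnKC ij).
elim: (j - i)%N => [|m IH]; first by rewrite addn0.
by rewrite addnS => H; apply: le_trans (IH (ltnW H)) (ltW (P_lt H)).
Qed.

(** Pieces are added one at a time: the continuous extension [dg] gives measurability, its extrema a
    bound. Each knot adds one arbitrary value, such as that of [derive1] where f is not
    differentiable. *)
Lemma piecewise_measurable_bounded i : (i <= n)%N ->
  measurable_fun `[0, P i] F /\ exists M, forall x, x \in `[0, P i] -> `|F x| <= M.
Proof.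
elim: i => [_|i IH i_n].
  rewrite P0 set_itv1; split; first exact: measurable_fun_set1.
  by exists `|F 0| => x; rewrite itvxx => /eqP ->.
have [mF [M HM]] := IH (ltnW i_n); have [dg dgc Fdg] := F_cont i_n.
have Pii := P_lt i_n; have Pi0 : 0 <= P i by rewrite -P0; apply: knot_le; rewrite (ltnW i_n).
have [cM cMab HcM] := EVT_max (ltW Pii) dgc.
have [cm cmab Hcm] := EVT_min (ltW Pii) dgc.
have -> : [set` `[0, P i.+1]] = [set` `[0, P i]] `|` [set` `]P i, P i.+1[] `|` [set P i.+1].
  apply/seteqP; split => x /=; rewrite !in_itv /=.
    move=> /andP[x0]; rewrite le_eqVlt => /predU1P[->|xP]; first by right.
    by left; case: (leP x (P i)) => xPi; [left|right]; apply/andP; split.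
  by move=> [[/andP[h1 h2]|/andP[h1 h2]]|->]; apply/andP; split; lra.
split.
  apply/measurable_funU => //; first exact: measurableU.
  split; last exact: measurable_fun_set1.
  apply/measurable_funU => //; split => //.
  apply: (@eq_measurable_fun _ _ _ _ _ dg); first by move=> x; rewrite inE => /Fdg ->.
  apply: subspace_continuous_measurable_fun => //.
  by apply: continuous_subspaceW dgc; exact: subset_itv_oo_cc.
exists (`|M| + `|dg cM| + `|dg cm| + `|F (P i.+1)|) => x; rewrite in_itv /= => /andP[x0].
have nM := normr_ge0 M; have n1 := normr_ge0 (dg cM); have n2 := normr_ge0 (dg cm).
have n3 := normr_ge0 (F (P i.+1)).
rewrite le_eqVlt => /predU1P[->|xP]; first lra.
case: (leP x (P i)) => xPi.
  have := HM x; rewrite in_itv /= x0 xPi => /(_ isT); have := ler_norm M; lra.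
have xin : x \in `]P i, P i.+1[ by rewrite in_itv /= xPi.
have xin' := subset_itv_oo_cc xin.
rewrite Fdg //; have := HcM _ xin'; have := Hcm _ xin'.
have := ler_norm (dg cM); have := ler_norm (- dg cm); rewrite normrN => h1 h2 h3 h4.
by rewrite ler_norml; apply/andP; split; lra.
Qed.

Lemma F_bounded : exists2 M, 0 <= M & forall x, x \in `[0, 1] -> `|F x| <= M.
Proof.
have [_ [M HM]] := piecewise_measurable_bounded (leqnn n).
exists `|M| => // x; rewrite -Pn => /HM; have := ler_norm M; lra.
Qed.

Lemma F_measurable : measurable_fun `[(0 : R), 1] F.
Proof. by have [mF _] := piecewise_measurable_bounded (leqnn n); rewrite -Pn. Qed.

Lemma itv01_bounded_integrable (G : R -> R) (M : R) : measurable_fun `[(0 : R), 1] G ->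
  (forall x, x \in `[0, 1] -> `|G x| <= M) -> mu.-integrable `[(0 : R), 1] (EFin \o G).
Proof.
move=> mG HM; apply: measurable_bounded_integrable => //.
  by rewrite /= lebesgue_measure_itv /= lte01 -EFinB ltry.
exists M; split; first exact: num_real.
by move=> y My x x01; apply: le_trans (HM x x01) (ltW My).
Qed.

Lemma F_integrable : mu.-integrable `[(0 : R), 1] (EFin \o F).
Proof. by have [M _ HM] := F_bounded; exact: itv01_bounded_integrable F_measurable HM. Qed.

Lemma F_sqr_integrable : mu.-integrable `[(0 : R), 1] (EFin \o (fun x => `|F x| ^+ 2)).
Proof.
have [M M0 HM] := F_bounded; apply: (@itv01_bounded_integrable _ (M ^+ 2)).
  by apply: measurable_funX; apply: measurableT_comp => //; exact: F_measurable.
by move=> x /HM H; rewrite ger0_norm ?sqr_ge0 // ler_sqr ?nnegrE.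
Qed.

Definition primitive (G : R -> R) x : R := \int[mu]_(t in `[0, x]) G t.

Lemma primitiveB (G : R -> R) x y : mu.-integrable `[(0 : R), 1] (EFin \o G) ->
  0 <= x -> x <= y -> y <= 1 ->
  primitive G y - primitive G x = \int[mu]_(t in `]x, y]) G t.
Proof.
move=> iG x0 xy y1; rewrite /primitive; apply: Rintegral_itvB.
- by apply: integrableS iG => //; apply: subset_itvl; rewrite bnd_simp.
- by rewrite bnd_simp.
- by rewrite bnd_simp.
Qed.

Let integrableS01 (G : R -> R) x y : mu.-integrable `[(0 : R), 1] (EFin \o G) ->
  0 <= x -> y <= 1 -> mu.-integrable `]x, y] (EFin \o G).
Proof.
move=> iG x0 y1; apply: integrableS iG => //.
by apply: subset_itv; rewrite bnd_simp.
Qed.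

Lemma itv_integral_cst x y (c : R) : x <= y -> \int[mu]_(t in `]x, y]) c = c * (y - x).
Proof.
move=> xy; rewrite Rintegral_cst //= lebesgue_measure_itv /= lte_fin.
by case: ifP xy => [_ _|/negbT]; rewrite -?EFinB //= -leNgt => h1 h2; have ->: y - x = 0 by lra.
Qed.

Lemma primitive_sqr_le x y : 0 <= x -> x <= y -> y <= 1 ->
  (primitive F y - primitive F x) ^+ 2
  <= (y - x) * (primitive (fun t => `|F t| ^+ 2) y - primitive (fun t => `|F t| ^+ 2) x).
Proof.
move=> x0; rewrite le_eqVlt => /predU1P[->|xy] y1; first by rewrite !subrr expr0n mul0r.
have iF := F_integrable; have iF2 := F_sqr_integrable.
rewrite !primitiveB ?(ltW xy) //.
set I := \int[_]_(_ in _) F _; set I2 := \int[_]_(_ in _) _.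
(* [0 <= int (F - lam) ^ 2] with [lam] the mean value of F *)
pose lam := I / (y - x).
have iF' := integrableS01 iF x0 y1.
have iL : mu.-integrable `]x, y] (EFin \o (fun t => 2 * lam * F t)).
  have := @integrableZl _ _ R mu _ (measurable_itv _) (2 * lam) _ iF'.
  by apply: eq_integrable => // t _ /=; rewrite EFinM.
have iC : mu.-integrable `]x, y] (EFin \o (fun _ => lam ^+ 2)).
  apply: measurable_bounded_integrable => //; last exact: bounded_cst.
  by rewrite /= lebesgue_measure_itv /= lte_fin xy -EFinB ltry.
have H : \int[mu]_(t in `]x, y]) (2 * lam * F t - lam ^+ 2) <= I2.
  apply: le_Rintegral => //.
  - have := @integrableB _ _ R mu _ (measurable_itv _) _ _ iL iC.
    by apply: eq_integrable => // t _ /=; rewrite EFinB.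
  - exact: integrableS01.
  - move=> t _; rewrite real_normK ?num_real //; have := sqr_ge0 (F t - lam); nra.
move: H; rewrite RintegralB //.
rewrite RintegralZl //.
rewrite itv_integral_cst ?(ltW xy) // -/I => H.
have yx0 : 0 < y - x by rewrite subr_gt0.
have -> : I ^+ 2 = (y - x) * (2 * lam * I - lam ^+ 2 * (y - x)).
  by rewrite /lam; field; rewrite lt0r_neq0.
by rewrite ler_pM2l.
Qed.

Lemma primitive_lipschitz : exists2 M, 0 <= M & forall x y,
  0 <= x -> x <= y -> y <= 1 -> `|primitive F y - primitive F x| <= M * (y - x).
Proof.
have [M M0 HM] := F_bounded; exists M => // x y x0 xy y1.
have iF := integrableS01 F_integrable x0 y1.
rewrite primitiveB //; last exact: F_integrable.
apply: le_trans (le_normr_Rintegral _ iF) _ => //.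
rewrite -itv_integral_cst //; apply: le_Rintegral => //.
- exact: integrable_norm.
- apply: measurable_bounded_integrable => //.
    by rewrite /= lebesgue_measure_itv /=; case: ifP => // _; rewrite -EFinB ltry.
  exact: bounded_cst.
- move=> t; rewrite /= in_itv /= => /andP[xt ty]; apply: HM.
  by rewrite in_itv /= (le_trans x0 (ltW xt)) (le_trans ty).
Qed.

End PiecewiseIntegral.
End Calculus.

(** * Jumps of a periodic piecewise C1 function *)

Section Counting.
Variable R : realType.

Lemma uniq_size_card_le (A : set R) (d : nat) (s : seq R) :
  (A #<= `I_d)%card -> uniq s -> (forall x, x \in s -> A x) -> (size s <= d)%N.
Proof.
move=> Ad s_uniq sA; apply: leq_trans (geq_card_fset_set Ad).
have finA : finite_set A by apply/finite_set_leP; exists d.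
apply: uniq_leq_size => // x xs.
by rewrite in_fset_set // inE; exact: sA.
Qed.

(** Used twice: for the jumps at the knots and for the errors at the sample points m / k. *)
Lemma sum_supported_le (A : set R) (d : nat) (s : seq nat) (p : nat -> R) (e : nat -> R) (D : R) :
  (A #<= `I_d)%card -> uniq [seq p i | i <- s] ->
  (forall i, i \in s -> e i != 0 -> A (p i)) -> (forall i, i \in s -> `|e i| <= D) ->
  0 <= D -> \sum_(i <- s) `|e i| <= d%:R * D.
Proof.
move=> Ad s_uniq sA sD D0; rewrite (bigID (fun i => e i != 0)) /=.
rewrite [X in _ + X]big1 ?addr0; last by move=> i; rewrite negbK => /eqP ->; rewrite normr0.
rewrite -big_filter; set s' := [seq i <- s | e i != 0].
have s'_uniq : uniq [seq p i | i <- s'].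
  by apply: subseq_uniq s_uniq; apply: map_subseq; exact: filter_subseq.
have s'd : (size s' <= d)%N.
  rewrite -(size_map p); apply: uniq_size_card_le Ad s'_uniq _ => x /mapP[i].
  by rewrite mem_filter => /andP[ei i_s] ->; exact: sA.
apply: le_trans (_ : \sum_(i <- s') D <= _).
  rewrite big_seq [leRHS]big_seq; apply: ler_sum => i.
  by rewrite mem_filter => /andP[_]; exact: sD.
by rewrite big_const_seq count_predT iter_addr_0 -[D *+ _]mulr_natl ler_wpM2r // ler_nat.
Qed.

End Counting.

Lemma derivable_continuous_at (R : realType) (f : R -> R) (x : R) :
  derivable f x 1 -> {for x, continuous f}.
Proof. by move=> fx; apply: differentiable_continuous; apply/derivable1_diffP. Qed.

Section Structure.
Variables (R : realType) (f : R -> R) (P : nat -> R) (n : nat).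
Hypothesis f_per : periodic f 1.
Hypothesis P0 : P 0%N = 0.
Hypothesis Pn : P n = 1.
Hypothesis P_lt : forall i, (i < n)%N -> P i < P i.+1.
Hypothesis f_C1 : forall i, (i < n)%N -> exists2 dg : R -> R,
  {within `[P i, P i.+1], continuous dg} &
  forall x, x \in `]P i, P i.+1[ -> is_derive x 1 f (dg x).
Local Notation mu := (@lebesgue_measure R).
Local Notation F := (derive1 f).

Lemma derive1_piecewise i : (i < n)%N -> exists2 dg : R -> R,
  {within `[P i, P i.+1], continuous dg} & {in `]P i, P i.+1[, F =1 dg}.
Proof.
move=> i_n; have [dg dgc Hdg] := f_C1 i_n; exists dg => // x xP.
by have [_ <-] := Hdg x xP; rewrite derive1E.
Qed.

Definition smooth x := primitive F x.

Let iF := F_integrable P0 Pn P_lt derive1_piecewise.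

Let n_gt0 : (0 < n)%N.
Proof. by case: n Pn => // H; move: H; rewrite P0 => /eqP; rewrite eq_sym oner_eq0. Qed.

Let P_le i j : (i <= j <= n)%N -> P i <= P j. Proof. exact: knot_le. Qed.

Let P_ge0 i : (i <= n)%N -> 0 <= P i. Proof. by move=> i_n; rewrite -P0; apply: P_le. Qed.

Let P_le1 i : (i <= n)%N -> P i <= 1.
Proof. by move=> i_n; rewrite -Pn; apply: P_le; rewrite i_n leqnn. Qed.

Lemma knot_ltn i j : (i < j <= n)%N -> P i < P j.
Proof.
move=> /andP[ij jn]; apply: lt_le_trans (P_lt (leq_trans ij jn)) _.
by apply: P_le; rewrite ij.
Qed.

(** The fundamental theorem on [x, y], which stays away from the knots. *)
Lemma piece_incr i x y : (i < n)%N -> P i < x -> x <= y -> y < P i.+1 ->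
  f y - f x = smooth y - smooth x.
Proof.
move=> i_n ix; rewrite le_eqVlt => /predU1P[->|xy] yi; first by rewrite !subrr.
have x0 : 0 <= x by apply: le_trans (P_ge0 (ltnW i_n)) _; exact: ltW.
have y1 : y <= 1 by apply: le_trans (P_le1 i_n); exact: ltW.
have [dg dgc Hdg] := f_C1 i_n.
have sub z : x <= z <= y -> z \in `]P i, P i.+1[.
  by move=> /andP[xz zy]; rewrite in_itv /=; apply/andP; split; lra.
have fd z : x <= z <= y -> derivable f z 1 by move=> /sub /Hdg [].
have Fdg z : x <= z <= y -> F z = dg z.
  by move=> /sub zP; have [_ <-] := Hdg z zP; rewrite derive1E.
rewrite /smooth primitiveB ?(ltW xy) //.
have FTC : (\int[mu]_(t in `[x, y]) (F t)%:E = (f y)%:E - (f x)%:E)%E.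
  apply: continuous_FTC2 => //.
  - have dgxy : {within `[x, y], continuous dg}.
      apply: continuous_subspaceW dgc => z /=; rewrite !in_itv /= => /andP[xz zy].
      by apply/andP; split; lra.
    apply: (@subspace_eq_continuous _ _ _ dg) => // z.
    by rewrite inE /= in_itv /= => zxy; exact/esym/Fdg.
  - split.
    + by move=> z; rewrite in_itv /= => /andP[xz zy]; apply: fd; rewrite !ltW.
    + by apply: cvg_at_right_filter; apply: derivable_continuous_at; apply: fd; rewrite lexx ltW.
    + by apply: cvg_at_left_filter; apply: derivable_continuous_at; apply: fd; rewrite lexx ltW.
rewrite Rintegral_itv_obnd_cbnd; last first.
  by apply: integrableS iF => //; apply: subset_itv; rewrite bnd_simp.
by rewrite /Rintegral FTC.
Qed.

(** The constant value of f - [smooth] on piece i, read at the midpoint because f is unconstrained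
    at the knots. *)
Definition level (i : nat) : R := f ((P i + P i.+1) / 2) - smooth ((P i + P i.+1) / 2).

Lemma pieceE i x : (i < n)%N -> P i < x < P i.+1 -> f x = smooth x + level i.
Proof.
move=> i_n /andP[ix xi]; have Pi := P_lt i_n; rewrite /level; set z := _ / 2.
have iz : P i < z by rewrite /z; lra.
have zi : z < P i.+1 by rewrite /z; lra.
case: (leP x z) => xz.
  by have := piece_incr i_n ix xz zi; lra.
by have := piece_incr i_n iz (ltW xz) xi; lra.
Qed.

Definition right_val (i : nat) : R := smooth (P i) + level i.
(* The left limit at the knot 0 is read off at 1 by periodicity. *)
Definition left_val (i : nat) : R :=
  if i is j.+1 then smooth (P i) + level j else smooth 1 + level n.-1.
Definition knot_jump (i : nat) : R := right_val i - left_val i.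

(** A linear rate from the Lipschitz bound on [smooth]; it gives both the one-sided limits and the
    limit that defines [jump]. *)
Lemma near_right : exists2 M, 0 <= M & forall i x, (i < n)%N -> P i < x < P i.+1 ->
  `|f x - right_val i| <= M * (x - P i).
Proof.
have [M M0 HM] := primitive_lipschitz P0 Pn P_lt derive1_piecewise; exists M => // i x i_n xP.
rewrite (pieceE i_n xP) /right_val opprD addrACA subrr addr0.
move: xP => /andP[ix xi]; apply: HM; rewrite ?P_ge0 ?(ltW ix) ?(ltnW i_n) //.
by apply: le_trans (P_le1 i_n); exact: ltW.
Qed.

Lemma near_left : exists2 M, 0 <= M & exists2 dl, 0 < dl &
  forall i x, (i < n)%N -> P i - dl < x < P i -> `|f x - left_val i| <= M * (P i - x).
Proof.
have [M M0 HM] := primitive_lipschitz P0 Pn P_lt derive1_piecewise; exists M => //.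
(* At most the least length of a piece, so that a left neighbourhood of any knot stays inside one
   piece. *)
pose dl := \big[Num.min/1]_(j < n) (P j.+1 - P j).
have dl_le j : (j < n)%N -> dl <= P j.+1 - P j.
  by move=> jn; rewrite /dl (bigD1 (Ordinal jn)) //= ge_min lexx.
exists dl.
  by rewrite /dl; apply: lt_bigmin => // j _; rewrite subr_gt0 P_lt.
have main j x : (j < n)%N -> P j.+1 - dl < x < P j.+1 ->
    `|f x - (smooth (P j.+1) + level j)| <= M * (P j.+1 - x).
  move=> jn /andP[h1 h2]; have h3 := dl_le j jn.
  have xP : P j < x < P j.+1 by rewrite h2 andbT; lra.
  rewrite (pieceE jn xP) opprD addrACA subrr addr0 distrC.
  by apply: HM; rewrite ?P_le1 ?(ltW h2) //; have := P_ge0 (ltnW jn); lra.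
case=> [|i] x i_n; last by apply: main; exact: ltnW.
have e : P n.-1.+1 = 1 by rewrite prednK.
rewrite P0 => /andP[h1 h2]; have := main n.-1 (x + 1).
rewrite e f_per prednK // => /(_ (leqnn _)) H.
rewrite /left_val; have -> : 0 - x = 1 - (x + 1) by ring.
by apply: H; apply/andP; split; lra.
Qed.

Lemma right_lim i : (i < n)%N -> f y @[y --> (P i)^'+] --> right_val i.
Proof.
move=> i_n; have [M M0 HM] := near_right.
by apply: (lim_at_right (M := M) (P_lt i_n)) => y yP; apply: HM.
Qed.

Lemma left_lim i : (i < n)%N -> f y @[y --> (P i)^'-] --> left_val i.
Proof.
move=> i_n; have [M M0 [dl dl0 HM]] := near_left.
apply: (@lim_at_left _ _ (P i - dl) _ _ M); first by rewrite gtrBl.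
by move=> y yP; apply: HM.
Qed.

(** The function under the limit is even in e, so e > 0 suffices, where [near_right] and [near_left]
    both apply. *)
Lemma jump_knot i : (i < n)%N -> jump f (P i) = `|knot_jump i|.
Proof.
move=> i_n; have [M M0 HM] := near_right; have [N N0 [dl dl0 HN]] := near_left.
apply/cvg_lim => //; apply: (@lim_at_dnbhs0 _ _ _ (M + N) (Num.min dl (P i.+1 - P i))).
  by rewrite lt_min dl0 subr_gt0 P_lt.
have pos e : 0 < e -> e < dl -> e < P i.+1 - P i ->
    `|f (P i + e) - f (P i - e) - knot_jump i| <= (M + N) * e.
  move=> e0 ed eP; have h1 : P i < P i + e < P i.+1 by apply/andP; split; lra.
  have h2 : P i - dl < P i - e < P i by apply/andP; split; lra.
  have := HM i _ i_n h1; have := HN i _ i_n h2.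
  have -> : P i - (P i - e) = e by ring.
  have -> : P i + e - P i = e by ring.
  by rewrite /knot_jump !ler_norml; lra.
move=> e; rewrite lt_min => /and3P[e0 ed eP].
have key : `|f (P i + `|e|) - f (P i - `|e|)| = `|f (P i + e) - f (P i - e)|.
  by case: (ger0P e) => // _; rewrite opprK distrC.
rewrite -key; apply: le_trans (ler_dist_dist _ _) _.
exact: pos.
Qed.

Lemma jump_inside i x : (i < n)%N -> P i < x < P i.+1 -> jump f x = 0.
Proof.
move=> i_n /andP[ix xi]; have [M M0 HM] := primitive_lipschitz P0 Pn P_lt derive1_piecewise.
apply/cvg_lim => //.
apply: (@lim_at_dnbhs0 _ _ _ (2 * M) (Num.min (x - P i) (P i.+1 - x))).
  by rewrite lt_min !subr_gt0 ix.
move=> e; rewrite lt_min => /and3P[e0 ed eP]; rewrite subr0 normr_id.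
have key : `|f (x + `|e|) - f (x - `|e|)| = `|f (x + e) - f (x - e)|.
  by case: (ger0P e) => // _; rewrite opprK distrC.
rewrite -key; move: (`|e|) e0 ed eP => z z0 zd zP.
rewrite (@pieceE i (x + z)) ?(@pieceE i (x - z)) //; try by apply/andP; split; lra.
rewrite opprD addrACA subrr addr0.
have -> : 2 * M * z = M * (x + z - (x - z)) by ring.
apply: HM; have := P_ge0 (ltnW i_n); have := P_le1 i_n; lra.
Qed.

Lemma locate x : x \in `[0, 1[ -> exists2 i, (i < n)%N & P i <= x < P i.+1.
Proof.
rewrite in_itv /= => /andP[x0 x1].
suff H m : (m <= n)%N -> x < P m -> exists2 i, (i < n)%N & P i <= x < P i.+1.
  by apply: (H n); rewrite ?Pn.
elim: m => [|m IH] mn xm; first by move: xm; rewrite P0 ltNge x0.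
case: (ltP x (P m)) => h; first by apply: IH => //; exact: ltnW.
by exists m => //; rewrite h.
Qed.

(** A crude bound, but it shows that the jumps are bounded above, without which the supremum in
    [max_jump] could not be used. *)
Lemma jump_le x : jump f x <= \sum_(0 <= i < n) `|knot_jump i|.
Proof.
have fz (z : R) (m : int) : f (z + m%:~R) = f z.
  by rewrite -[m%:~R]mul1r; apply: (@period_int R f 1 m z f_per).
have -> : jump f x = jump f (x - (Num.floor x)%:~R).
  suff E : (fun e => `|f (x + e) - f (x - e)|) =
     (fun e => `|f (x - (Num.floor x)%:~R + e) - f (x - (Num.floor x)%:~R - e)|).
    by rewrite /jump E.
  apply/funext => e.
  rewrite -(fz (x - _ + e) (Num.floor x)) -(fz (x - _ - e) (Num.floor x)).
  by congr (`|f _ - f _|); ring.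
set y := x - _; have y01 : y \in `[0, 1[.
  rewrite in_itv /= /y; have := floor_le x; have := floorD1_gt x.
  by rewrite rmorphD /= => h1 h2; apply/andP; split; lra.
have [i i_n /andP[]] := locate y01; rewrite le_eqVlt => /predU1P[<- _|iy yi].
  rewrite jump_knot // big_mkord (bigD1 (Ordinal i_n)) //= lerDl.
  by apply: sumr_ge0.
by rewrite (jump_inside i_n) ?iy // sumr_ge0.
Qed.

Lemma jump_le_max x : jump f x <= max_jump f.
Proof.
apply: ub_le_sup; last by exists x.
by exists (\sum_(0 <= i < n) `|knot_jump i|) => _ [z _ <-]; exact: jump_le.
Qed.

Lemma knot_jump_le i : (i < n)%N -> `|knot_jump i| <= max_jump f.
Proof. by move=> i_n; rewrite -jump_knot //; exact: jump_le_max. Qed.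

Lemma max_jump_ge0 : 0 <= max_jump f.
Proof. exact: le_trans (normr_ge0 _) (knot_jump_le n_gt0). Qed.

Lemma knot_continuous i : (i < n)%N -> {for P i, continuous f} ->
  right_val i = f (P i) /\ left_val i = f (P i).
Proof.
move=> i_n fc; split.
  by apply: cvg_unique (right_lim i_n) _ => //; exact: cvg_at_right_filter.
by apply: cvg_unique (left_lim i_n) _ => //; exact: cvg_at_left_filter.
Qed.

Lemma knot_discontinuity i : (i < n)%N -> 
  (f (P i) != right_val i) || (knot_jump i != 0) -> discontinuities f (P i).
Proof.
move=> i_n H; split.
  by rewrite in_itv /= P_ge0 ?(ltnW i_n) // -Pn knot_ltn // i_n leqnn.
move=> /(knot_continuous i_n)[e1 e2]; move: H.
by rewrite /knot_jump e1 e2 subrr !eqxx.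
Qed.

Lemma sum_knot_jump_le (d : nat) : (discontinuities f #<= `I_d)%card ->
  \sum_(0 <= i < n) `|knot_jump i| <= d%:R * max_jump f.
Proof.
move=> fd; apply: (@sum_supported_le R (discontinuities f) d _ P).
- exact: fd.
- rewrite map_inj_in_uniq ?iota_uniq // => i j; rewrite !mem_index_iota => /andP[_ i_n] /andP[_ jn].
  case: (ltngtP i j) => // ij e.
  + by have := @knot_ltn i j; rewrite ij (ltnW jn) e ltxx => /(_ isT).
  + by have := @knot_ltn j i; rewrite ij (ltnW i_n) e ltxx => /(_ isT).
- move=> i; rewrite mem_index_iota => /andP[_ i_n] Ji.
  by apply: knot_discontinuity => //; rewrite Ji orbT.
- by move=> i; rewrite mem_index_iota => /andP[_ i_n]; exact: knot_jump_le.
- exact: max_jump_ge0.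
Qed.

(* [model] is the right-continuous version of [f] on [[0, 1[]. *)
Definition step (x : R) : R := \sum_(1 <= j < n) ((P j <= x)%R : nat)%:R * knot_jump j.

Definition model (x : R) : R := smooth x + level 0 + step x.

Lemma modelE i x : (i < n)%N -> P i <= x < P i.+1 -> model x = smooth x + level i.
Proof.
move=> i_n /andP[ix xi]; rewrite /model -addrA; congr (_ + _).
suff H m : (m < n)%N ->
    \sum_(1 <= j < m.+1) ((P j <= x)%R : nat)%:R * knot_jump j = level (minn m i) - level 0.
  by rewrite /step -(prednK n_gt0) H ?prednK // (minn_idPr _) ?subrKC //; lia.
elim: m => [|m IH] mn; first by rewrite big_geq // min0n subrr.
rewrite big_nat_recr // [LHS]/= IH ?(ltnW mn) // /knot_jump /right_val /left_val.
case: (leqP m.+1 i) => mi.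
  have -> : P m.+1 <= x by apply: le_trans ix; apply: P_le; rewrite mi ltnW.
  by rewrite (minn_idPl (ltnW mi)) mul1r; ring.
have -> : P m.+1 <= x = false.
  apply/negbTE; rewrite -ltNge; apply: lt_le_trans xi _; apply: P_le; rewrite mi; exact: ltnW.
have im : (i <= m)%N by [].
by rewrite (minn_idPr im) mul0r addr0.
Qed.

(** At a knot, f is within D0 of one of the one-sided limits, and these differ by at most D0; off
    the knots [model] equals f. *)
Lemma model_error x : values_near_limits f -> x \in `[0, 1[ ->
  `|f x - model x| <= 2 * max_jump f /\ (f x - model x != 0 -> discontinuities f x).
Proof.
move=> fv x01; have D0 := max_jump_ge0; have [i i_n xi] := locate x01.
rewrite (modelE i_n xi); move: xi => /andP[]; rewrite le_eqVlt => /predU1P[<- _|ix xi].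
  rewrite -/(right_val i); split; last first.
    by rewrite subr_eq0 => H; apply: knot_discontinuity => //; rewrite H.
  have [l ll fl] := fv (P i); have J := knot_jump_le i_n.
  have : l = right_val i \/ l = left_val i.
    case: ll => ll; [right|left].
      by apply: cvg_unique ll (left_lim i_n).
    by apply: cvg_unique ll (right_lim i_n).
  move: J fl; rewrite /knot_jump !ler_norml => J fl.
  by case=> e; move: fl; rewrite e; lra.
have xP : P i < x < P i.+1 by rewrite ix.
rewrite (pieceE i_n xP) subrr normr0 eqxx; split => //.
by rewrite mulr_ge0.
Qed.

(** The levels telescope around the period, because the jump at the knot 0 is measured from the last
    piece. This makes the function G of [cot_sum_le] periodic. *)
Lemma smooth_closing : smooth 1 + \sum_(0 <= i < n) knot_jump i = smooth 0.
Proof.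
have H m : (m < n)%N -> \sum_(0 <= j < m.+1) knot_jump j
    = level m - level n.-1 + smooth 0 - smooth 1.
  elim: m => [|m IH] mn; first by rewrite big_nat1 /knot_jump /right_val /left_val P0; ring.
  by rewrite big_nat_recr //= IH ?(ltnW mn) // /knot_jump /right_val /left_val; ring.
by have := H n.-1; rewrite prednK // => -> //; ring.
Qed.

End Structure.

(** * Conclusion *)

Lemma saw_indicator (R : realType) (p y : R) : 0 <= p < 1 -> 0 <= y < 1 ->
  ((p <= y)%R : nat)%:R = y - p + 2^-1 - saw (y - p).
Proof.
move=> p01 y01; case: leP => py.
  by rewrite saw_itv; [rewrite -[LHS]/(1 : R); field|apply/andP; split; lra].
by rewrite -(sawDz (y - p) 1) saw_itv; [rewrite -[LHS]/(0 : R); field|apply/andP; split; lra].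
Qed.

Section Decomposition.
Variables (R : realType) (f : R -> R) (P : nat -> R) (n : nat) (d : nat).
Hypothesis f_per : periodic f 1.
Hypothesis P0 : P 0%N = 0.
Hypothesis Pn : P n = 1.
Hypothesis P_lt : forall i, (i < n)%N -> P i < P i.+1.
Hypothesis f_C1 : forall i, (i < n)%N -> exists2 dg : R -> R,
  {within `[P i, P i.+1], continuous dg} &
  forall x, x \in `]P i, P i.+1[ -> is_derive x 1 f (dg x).
Hypothesis f_disc : (discontinuities f #<= `I_d)%card.
Hypothesis f_val : values_near_limits f.

Let D0_ge0 := max_jump_ge0 f_per P0 Pn P_lt f_C1.
Let J := knot_jump f P n.
Let SJ := \sum_(0 <= j < n) J j.

Let SJ_le : `|SJ| <= d%:R * max_jump f.
Proof.
apply: le_trans (ler_norm_sum _ _ _) _.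
exact: (sum_knot_jump_le f_per P0 Pn P_lt f_C1).
Qed.

Lemma deriv_L2norm_ge0 : 0 <= deriv_L2norm f. Proof. exact: sqrtr_ge0. Qed.

(** Cauchy-Schwarz on each interval of length 1 / k, after which the integrals of |f'|^2
    telescope. *)
Lemma sum_smooth_increments_le (k : nat) : (0 < k)%N ->
  \sum_(0 <= m < k) (smooth f (m.+1%:R / k%:R) - smooth f (m%:R / k%:R)) ^+ 2
  <= deriv_L2norm f ^+ 2 / k%:R.
Proof.
move=> k0; have kR : (0 : R) < k%:R by rewrite ltr0n.
pose Psi := primitive (fun t => `|derive1 f t| ^+ 2).
apply: le_trans (_ : \sum_(0 <= m < k) k%:R^-1 *
    (Psi (m.+1%:R / k%:R) - Psi (m%:R / k%:R)) <= _).
  rewrite !big_nat; apply: ler_sum => m /andP[_ mk].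
  have e : k%:R^-1 = m.+1%:R / k%:R - m%:R / k%:R :> R.
    by rewrite -mulrBl -[m.+1%:R]natr1 addrAC subrr add0r mul1r.
  rewrite [X in _ <= X * _]e.
  apply: (primitive_sqr_le P0 Pn P_lt (derive1_piecewise f_C1)).
  - by rewrite divr_ge0.
  - by rewrite ler_pM2r ?invr_gt0 // ler_nat.
  - by rewrite ler_pdivrMr // mul1r ler_nat.
rewrite -mulr_sumr (telescope_sumr (fun m : nat => Psi (m%:R / k%:R))) //.
rewrite mulrC; apply: ler_wpM2r; first by rewrite invr_ge0 ltW.
rewrite divff ?lt0r_neq0 // mul0r.
have Psi_ge0 x : 0 <= Psi x by apply: Rintegral_ge0 => t _; apply: sqr_ge0.
rewrite /deriv_L2norm sqr_sqrtr; last exact: (Psi_ge0 1).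
by rewrite gerBl.
Qed.

Lemma cot_sum_le (h : int) (k : nat) (M : R) : (0 < k)%N -> coprimez h k%:Z ->
  (forall x, `|k%:R^-1 * (\sum_(1 <= m < k) saw (m%:R / k%:R - x)
               * cot (pi * (m%:R * h%:~R / k%:R)))| <= M) ->
  `|cot_sum f h k| <= d%:R * max_jump f * M + 6 * (d%:R * max_jump f + deriv_L2norm f).
Proof.
move=> k0 hk HM; have kR : (0 : R) < k%:R by rewrite ltr0n.
have dD0 : 0 <= d%:R * max_jump f by rewrite mulr_ge0.
have D1 := deriv_L2norm_ge0.
pose w (m : nat) : R := cot (pi * (m%:R * h%:~R / k%:R)).
(* [step] omits the knot 0, whose indicator is always 1 here; completing the sum to all j is
   compensated by - J 0. *)
pose K := level f P 0 - J 0%N + \sum_(0 <= j < n) (2^-1 - P j) * J j.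
(* The linear term collects the slopes from [saw_indicator]; with it G k = G 0, as
   [cot_sum_smooth_le] requires. *)
pose G (m : nat) := smooth f (m%:R / k%:R) + SJ * (m%:R / k%:R) + K.
pose err (m : nat) := f (m%:R / k%:R) - model f P n (m%:R / k%:R).
have m01 (m : nat) : (m < k)%N -> m%:R / k%:R \in `[(0 : R), 1[.
  by move=> mk; rewrite in_itv /= divr_ge0 //= ltr_pdivrMr // mul1r ltr_nat.
have n0 : (0 < n)%N.
  by rewrite lt0n; apply/eqP => e; move: Pn; rewrite e P0 => /eqP; rewrite eq_sym oner_eq0.
have P01 j : (j < n)%N -> 0 <= P j < 1.
  move=> jn; rewrite -{1}P0 -Pn (knot_le P_lt) ?(ltnW jn) //=.
  by apply: (knot_ltn P_lt); rewrite jn leqnn.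
have fE m : (m < k)%N -> f (m%:R / k%:R) =
    G m - (\sum_(0 <= j < n) J j * saw (m%:R / k%:R - P j)) + err m.
  move=> mk; rewrite /err -[LHS](subrK (model f P n (m%:R / k%:R))) addrC; congr (_ + _).
  have := m01 m mk; rewrite in_itv /= /G; set y := _ / _ => y01.
  rewrite /model -!addrA; congr (_ + _).
  have -> : step f P n y = \sum_(0 <= j < n) ((P j <= y)%R : nat)%:R * J j - J 0%N.
    rewrite [in RHS]big_ltn // P0; have -> : 0 <= y by case/andP: y01.
    by rewrite mul1r addrAC subrr add0r.
  have -> : \sum_(0 <= j < n) ((P j <= y)%R : nat)%:R * J j
      = \sum_(0 <= j < n) (J j * y + (2^-1 - P j) * J j - J j * saw (y - P j)).
    by rewrite !big_nat; apply: eq_bigr => j /andP[_ jn]; rewrite saw_indicator ?P01 //; ring.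
  by rewrite sumrB big_split /= -mulr_suml -/SJ /K; ring.
have Gk : G k = G 0%N.
  rewrite /G divff ?lt0r_neq0 // mul0r mulr1 mulr0 addr0; congr (_ + _).
  exact: (smooth_closing f P0 Pn).
have -> : cot_sum f h k = k%:R^-1 * (\sum_(1 <= m < k) G m * w m)
   - \sum_(0 <= j < n) J j * (k%:R^-1 * \sum_(1 <= m < k) saw (m%:R / k%:R - P j) * w m)
   + k%:R^-1 * (\sum_(1 <= m < k) err m * w m).
  have -> : \sum_(0 <= j < n) J j * (k%:R^-1 * \sum_(1 <= m < k) saw (m%:R / k%:R - P j) * w m)
    = k%:R^-1 * \sum_(1 <= m < k) (\sum_(0 <= j < n) J j * saw (m%:R / k%:R - P j)) * w m.
    under eq_bigr do rewrite mulrCA mulr_sumr.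
    rewrite -mulr_sumr exchange_big /=; congr (_ * _); apply: eq_bigr => m _.
    by rewrite mulr_suml; apply: eq_bigr => j _; rewrite mulrA.
  rewrite -mulrBr -mulrDr /cot_sum; congr (_ * _).
  rewrite -sumrB -big_split /= !big_nat; apply: eq_bigr => m /andP[_ mk].
  by rewrite fE // -/(w m); ring.
(* Here D = 2 (d D0 + D1): the increments are those of [smooth] plus SJ / k, separated by (x + y)^2
   <= 2 x^2 + 2 y^2. This gives 4 of the final 6; the errors below give 2. *)
have HG : `|k%:R^-1 * (\sum_(1 <= m < k) G m * w m)|
    <= 2 * (2 * (d%:R * max_jump f + deriv_L2norm f)).
  apply: cot_sum_smooth_le => //; last by rewrite mulr_ge0 // addr_ge0.
  apply: le_trans (_ : \sum_(0 <= m < k)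
     (2 * (smooth f (m.+1%:R / k%:R) - smooth f (m%:R / k%:R)) ^+ 2
      + 2 * (SJ / k%:R) ^+ 2) <= _).
    apply: ler_sum => m _.
    have -> : G m.+1 - G m
       = (smooth f (m.+1%:R / k%:R) - smooth f (m%:R / k%:R)) + SJ / k%:R.
      by rewrite /G -[m.+1%:R]natr1; ring.
    move: (smooth f _ - _) (SJ / _) => x y; have := sqr_ge0 (x - y); nra.
  rewrite big_split /= -mulr_sumr sumr_const_nat subn0 -[(2 * _) *+ k]mulr_natl.
  have H1 := sum_smooth_increments_le k0.
  have H2 : SJ ^+ 2 <= (d%:R * max_jump f) ^+ 2.
    by rewrite -[SJ ^+ 2]real_normK ?num_real // ler_sqr ?nnegrE.
  have -> : k%:R * (2 * (SJ / k%:R) ^+ 2) = 2 * SJ ^+ 2 / k%:R by field; rewrite lt0r_neq0.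
  apply: le_trans (_ : 2 * (deriv_L2norm f ^+ 2 / k%:R) + 2 * SJ ^+ 2 / k%:R <= _).
    by rewrite lerD2r ler_wpM2l.
  rewrite mulrA -mulrDl; apply: ler_wpM2r; first by rewrite invr_ge0 ltW.
  by move: H2 dD0 D1; move: (_ * max_jump f) (deriv_L2norm f) => a b; nra.
have HJ : `|\sum_(0 <= j < n) J j *
     (k%:R^-1 * \sum_(1 <= m < k) saw (m%:R / k%:R - P j) * w m)| <= d%:R * max_jump f * M.
  apply: le_trans (ler_norm_sum _ _ _) _.
  apply: le_trans (_ : \sum_(0 <= j < n) `|J j| * M <= _).
    by apply: ler_sum => j _; rewrite normrM ler_wpM2l.
  rewrite -mulr_suml ler_wpM2r ?(le_trans _ (HM 0)) //.
  exact: (sum_knot_jump_le f_per P0 Pn P_lt f_C1).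
(* The bound k on the cotangents cancels 1 / k, so each of the at most d bad sample points costs 2
   D0. *)
have He : `|k%:R^-1 * (\sum_(1 <= m < k) err m * w m)| <= 2 * (d%:R * max_jump f).
  rewrite normrM ger0_norm ?invr_ge0 // ler_pdivrMl //.
  apply: le_trans (ler_norm_sum _ _ _) _.
  apply: le_trans (_ : \sum_(1 <= m < k) k%:R * `|err m| <= _).
    rewrite !big_nat; apply: ler_sum => m /andP[m0 mk].
    rewrite normrM mulrC ler_wpM2r //.
    have -> : w m = cot (pi * ((m%:Z * h)%:~R / k%:R)) by rewrite intrM -pmulrn.
    apply: norm_cot_pi_frac_le => //; rewrite Gauss_dvdzl; last by rewrite coprimez_sym.
    by apply/negP => /(dvdn_leq m0); rewrite leqNgt mk.
  rewrite -mulr_sumr ler_wpM2l //.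
  have -> : 2 * (d%:R * max_jump f) = d%:R * (2 * max_jump f) by ring.
  apply: (@sum_supported_le R (discontinuities f) d _ (fun m => m%:R / k%:R)) => //.
  - rewrite map_inj_in_uniq ?iota_uniq // => i j _ _ /(mulIf _).
    by rewrite invr_eq0 lt0r_neq0 // => /(_ isT) /eqP; rewrite eqr_nat => /eqP.
  - move=> m; rewrite mem_index_iota => /andP[_ mk].
    by have [_] := model_error f_per P0 Pn P_lt f_C1 f_val (m01 m mk).
  - move=> m; rewrite mem_index_iota => /andP[_ mk].
    by have [] := model_error f_per P0 Pn P_lt f_C1 f_val (m01 m mk).
  - by rewrite mulr_ge0.
apply: le_trans (ler_normD _ _) _.
have := ler_normB (k%:R^-1 * (\sum_(1 <= m < k) G m * w m))
  (\sum_(0 <= j < n) J j * (k%:R^-1 * \sum_(1 <= m < k) saw (m%:R / k%:R - P j) * w m)).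
lra.
Qed.

End Decomposition.

Lemma piecewise_C1_knots (R : realType) (f : R -> R) : piecewise_C1 f ->
  exists n (P : nat -> R), [/\ P 0%N = 0, P n = 1, forall i, (i < n)%N -> P i < P i.+1 &
    forall i, (i < n)%N -> exists2 dg : R -> R,
      {within `[P i, P i.+1], continuous dg} &
      forall x, x \in `]P i, P i.+1[ -> is_derive x 1 f (dg x)].
Proof.
move=> [t [t_part f_C1]]; exists (size t), (nth 0 (0 :: t)); split=> //.
- exact: itv_partition_nth_size.
- by case: t_part => /(pathP 0).
- move=> i i_t; have [g [dg [dgc dgl]] fg] := f_C1 i i_t; exists dg => // x xP.
  by apply: (C1_on_is_derive _ fg xP); apply: dgl; exact: subset_itv_oo_cc.
Qed.

Theorem theorem1 (R : realType) :
  exists C : R,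
    forall (f : R -> R) (d : nat),
      periodic f 1 -> piecewise_C1 f ->
      (discontinuities f #<= `I_d)%card ->
      values_near_limits f ->
    forall (h : int) (k : nat),
      (0 < k)%N -> coprimez h k%:Z ->
    forall (b0 : int) (b : seq nat),
      is_cfrac_expansion (h%:~R / k%:R) b0 b ->
    let D0 := max_jump f in
    let D1 := deriv_L2norm f in
    let r := size b in
    let v := cf_den b in
      `|cot_sum f h k|
        <= d%:R * D0 / (pi * k%:R)
             * (\sum_(1 <= m < r.+1) (v m)%:R * ln ((v m)%:R / (v m.-1)%:R))
           + C * (d%:R * D0 + D1)
      /\
      (forall hbar : int, (h * hbar = 1 %[mod k%:Z])%Z ->
        `|cot_sum f hbar k|
          <= d%:R * D0 / pi
               * (\sum_(0 <= m < r) ln ((v m.+1)%:R / (v m)%:R) / (v m)%:R)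
             + C * (d%:R * D0 + D1)).
Proof.
(* 47 = 41 + 6, from the sawtooth bounds and from [cot_sum_le]. *)
exists 47 => f d f_per f_pw f_disc f_val h k k0 hk b0 b [hE b_gt0 _] D0 D1 r v.
have [n [P [P0 Pn P_lt f_C1]]] := piecewise_C1_knots f_pw.
have D0_ge0 : 0 <= D0 := max_jump_ge0 f_per P0 Pn P_lt f_C1.
have D1_ge0 : 0 <= D1 := deriv_L2norm_ge0 f.
have dD0 : 0 <= d%:R * D0 by rewrite mulr_ge0.
have main g M := @cot_sum_le R f P n d f_per P0 Pn P_lt f_C1 f_disc f_val g k M k0.
(* Without partial quotients h / k is an integer, so k = 1 and all sums are empty. *)
case: (posnP (size b)) => [/size0nil b_nil|s0].
  have k1 : k = 1%N.
    move: hE; rewrite b_nil /= => hE.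
    have kR : (k%:R : rat) != 0 by rewrite pnatr_eq0 -lt0n.
    have h_k : h = b0 * k%:Z.
      apply: (intr_inj (R := rat)); rewrite intrM -pmulrn; apply: (mulIf (invr_neq0 kR)).
      by rewrite hE mulfK.
    by move: hk; rewrite h_k /coprimez gcdzC gcdzMl => /eqP [].
  have cot0 g : cot_sum f g k = 0 by rewrite /cot_sum k1 big_geq // mulr0.
  have C0 : 0 <= 47 * (d%:R * D0 + D1) by rewrite mulr_ge0 // addr_ge0.
  rewrite /r b_nil; split => [|hbar _]; rewrite cot0 normr0 big_geq //= mulr0 add0r //.
split.
  apply: le_trans (main _ _ hk (fun x => saw_cot_sum_den_le x k0 hk b_gt0 hE s0)) _.
  rewrite -/D0 -/D1 -/r -/v mulrDr mulrA -addrA; apply: lerD; first by [].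
  by rewrite mulrDr; lra.
move=> hbar hh.
have hbk : coprimez hbar k%:Z.
  move/eqP: hh; rewrite eqz_mod_dvd => /dvdzP[q Hq]; apply/coprimezP.
  by exists (h, - q) => /=; rewrite mulNr -Hq; ring.
apply: le_trans (main _ _ hbk (fun x => saw_cot_sum_inv_le x k0 hk b_gt0 hE hh s0)) _.
rewrite -/D0 -/D1 -/r -/v mulrDr mulrA -addrA; apply: lerD; first by [].
by rewrite mulrDr; lra.
Qed.
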